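(* Let $U(x)=-e^{-\gamma x}$, $x\in\mathbb R$, with $\gamma>0$, and define $$S^0:=\Big\{i\in S\ \Big|\ \Big(\sum_{j\ne i}\frac{q_{ij}}{q_i-c\gamma}e^{-\gamma g(j)}\ge e^{-\gamma g(i)}\ \text{and}\ q_i>c\gamma\Big)\ \text{or}\ q_i\le c\gamma\Big\}.$$ Suppose that for all $i\in S^0$ and $j\ne i$ the implication $q_{ij}\ne0\Longrightarrow j\in S^0$ is valid. Then for $i\in S^0$ the maximizer $f^*$ in $$W(i)=\max\bigg\{-e^{-\gamma g(i)},\ \sum_{j\ne i}\frac{q_{ij}}{q_i-c\gamma}W(j)\bigg\}\qquad(q_i>c\gamma)$$ is given by $f^*(i)=0$, and $W(i)=-e^{-\gamma g(i)}$. If $i\notin S^0$, then $f^*(i)=\infty$. Thus the stopping time $\tau^*$ determined by $f^*$ satisfies $$\tau^*=\inf\{t\ge0\mid X_t\in S^0\}.$$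
   Context: Markov chain: on a probability space $(\Omega,\mathcal F,\mathbb P)$, $(X_t)_{t\ge0}$ is a right-continuous continuous-time Markov chain with countable state space $S$ and intensity matrix $Q=(q_{ij})$, $0<q_i:=-q_{ii}=\sum_{j\ne i}q_{ij}<\infty$. Its jump times are $0=S_0<S_1<S_2<\dots$, $Z_n:=X_{S_n}$, and $X_t=\sum_{k\ge0}Z_k1_{\{S_k\le t<S_{k+1}\}}$ for all $t\ge0$; $S_{k+1}-S_k\sim\exp(q_{Z_k})$ and $\mathbb P(Z_{k+1}=j\mid Z_k=i)=q_{ij}/q_i$ for $j\ne i$. $(\mathcal F^X_t)$ is the natural filtration of $X$; $\mathbb P_i,\mathbb E_i$ denote probability and expectation given $X_0=i$. $g:S\to\mathbb R$ is a reward function and $c>0$ a cost rate. $\Sigma$ is the set of $(\mathcal F^X_t)$-stopping times $\tau:\Omega\to[0,\infty)$ with $\mathbb P_i(\tau<\infty)=1$ for all $i\in S$. Standing assumptions: (A1) $\sup_{\tau\in\Sigma}\mathbb E_i[g^+(X_\tau)-c\tau]<\infty$ for all $i\in S$; (A2) $\liminf_{n\to\infty}\mathbb E_i[U(g(X_{\tau\wedge S_n})-c(t+\tau\wedge S_n))]\ge\mathbb E_i[U(g(X_\tau)-c(t+\tau))]$ for all $i\in S$, $t\ge0$, $\tau\in\Sigma$. Markovian stopping times: a Markovian stopping time is identified with a sequence $\tau=(h_0,h_1,\dots)$ of measurable maps $h_k:[0,\infty)\times S\to[0,\infty]$; given elapsed time $t\ge0$ it denotes the random time $\tau=S_k+h_k(t+S_k,Z_k)$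 for the smallest $k\ge0$ with $S_k+h_k(t+S_k,Z_k)<S_{k+1}$ (and $\tau=\infty$ if there is none). $\Sigma^M$ is the class of such sequences for which $\tau$ is $\mathbb P_i$-a.s. finite for all $i\in S$, $t\ge0$. Value function: $V(t,i):=\sup_{\tau\in\Sigma^M}\mathbb E_i\big[U\big(g(X_\tau)-c(t+\tau)\big)\big]$, with $\tau$ formed with elapsed time $t$; for the exponential utility $V(t,i)=e^{c\gamma t}W(i)$ with $W(i):=V(0,i)$. For $q_i\le c\gamma$ one has $W(i)=-e^{-\gamma g(i)}$, and for $q_i>c\gamma$ the function $W$ satisfies the displayed max-equation. Maximizer $f^*:S\to\{0,\infty\}$: $f^*(i)=0$ if $q_i\le c\gamma$, or if $q_i>c\gamma$ and the maximum is attained in the first expression (this value is chosen in case of a tie); $f^*(i)=\infty$ if the maximum is attained in the second expression. The stopping time $\tau^*$ determined by $f^*$ is the one with $h_k(t,i)=f^*(i)$ for all $k$, i.e. $\tau^*=f^*(Z_0)1_{\{\tau^*<S_1\}}+\sum_{k\ge1}(f^*(Z_k)+S_k)1_{\{S_k\le\tau^*<S_{k+1}\}}$. *)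

(* Defs.v *)
From HB Require Import structures.
From mathcomp Require Import all_boot all_order all_algebra.
From mathcomp Require Import all_classical all_reals all_analysis.
From mathcomp Require Import measurable_realfun.

Set Implicit Arguments.
Unset Strict Implicit.
Unset Printing Implicit Defensive.
Import Order.TTheory GRing.Theory Num.Theory.
Import numFieldNormedType.Exports.

Local Open Scope classical_set_scope.
Local Open Scope ring_scope.

Definition rate (R : realType) (S : countType) (q : S -> S -> R) (i : S) : R :=
  - q i i.

Record intensity_matrix (R : realType) (S : countType) (q : S -> S -> R) :
    Prop := IntensityMatrix {
  intensity_offdiag_ge0 : forall i j, j != i -> 0 <= q i j ;
  intensity_rate_gt0 : forall i, 0 < rate q i ;
  intensity_rowsum :
    forall i, (\esum_(j in [set j | j != i]) (q i j)%:E = (rate q i)%:E)%E }.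

Definition jump_prob (R : realType) (S : countType) (q : S -> S -> R)
    (i j : S) : R :=
  if j == i then 0 else q i j / rate q i.

Section chain.
Context {d : measure_display} {Omega : measurableType d} {R : realType}
  {S : countType}.
Implicit Types (q : S -> S -> R) (X : R -> Omega -> S) (T : nat -> Omega -> R)
  (P : S -> probability Omega R) (U : R -> R) (g : S -> R) (c t : R) (i : S)
  (tau : Omega -> \bar R) (h : nat -> R -> S -> \bar R).

Definition embedded X T (n : nat) (w : Omega) : S := X (T n w) w.

(* Time ranges over [0, +oo[: the values [X t] for [t < 0] play no role. The
   jump times [S_n] of the process are written [T n], and [P i] is the
   probability given [X_0 = i].
   [chain_law] is the jump chain / holding time description of the chain: under
   [P i] the embedded chain starts at [i] and is Markov with transition
   probabilities [q_ij / q_i], and given the embedded chain the sojourn times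
   are independent, the [k]-th one being exponential of rate [q_(Z_k)]. *)
Record markov_chain q X T P : Prop := MarkovChain {
  chain_measurable :
    forall t i, 0 <= t -> measurable [set w | X t w = i] ;
  chain_time0 : forall w, T 0%N w = 0 ;
  chain_time_lt : forall n w, T n w < T n.+1 w ;
  chain_jump : forall n w, embedded X T n.+1 w <> embedded X T n w ;
  chain_path : forall n t w,
    T n w <= t < T n.+1 w -> X t w = embedded X T n w ;
  chain_nonexplosive : forall t w, 0 <= t -> exists n, T n w <= t < T n.+1 w ;
  chain_law : forall i (n : nat) (s : nat -> S) (B : nat -> set R),
    (forall k, measurable (B k)) ->
    P i [set w | (forall k, (k <= n)%N -> embedded X T k w = s k) /\
                 (forall k, (k < n)%N -> B k (T k.+1 w - T k w))] =
    ((s 0%N == i)%:R%:E *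
     \prod_(k < n) ((jump_prob q (s k) (s k.+1))%:E *
                    exponential_prob (rate q (s k)) (B k)))%E }.

Definition natural_filtration X (t : R) : set (set Omega) :=
  <<s [set A | exists r i, 0 <= r <= t /\ A = [set w | X r w = i]] >>.

(* Stopping times take values in [0, +oo] and are almost surely finite whatever
   the initial state: a Markovian time may be infinite on a null set. *)
Definition stopping_time X P tau : Prop :=
  [/\ forall w, (0 <= tau w)%E,
      forall t, 0 <= t -> natural_filtration X t [set w | (tau w <= t%:E)%E] &
      forall i, P i [set w | (tau w < +oo)%E] = 1%E].

(* [X_tau]; on the null set where [tau] is infinite the value is irrelevant. *)
Definition stopped X tau (w : Omega) : S := X (fine (tau w)) w.

Definition stop_min tau T (n : nat) (w : Omega) : \bar R :=
  Order.min (tau w) (T n w)%:E.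

Definition expected_utility X P U g c t i tau : \bar R :=
  (\int[P i]_w (U (g (stopped X tau w) - c * (t + fine (tau w))))%:E)%E.

(* An integral of the form [+oo - +oo] evaluates to [-oo], so that only the
   stopping times whose expectation is defined matter for the supremum. *)
Definition assumption_A1 X P g c : Prop := forall i,
  (ereal_sup [set (\int[P i]_w
                 (Order.max (g (stopped X tau w)) 0 - c * fine (tau w))%:E)%E
             | tau in stopping_time X P] < +oo)%E.

Definition assumption_A2 X T P U g c : Prop :=
  forall i t tau, 0 <= t -> stopping_time X P tau ->
  (expected_utility X P U g c t i tau <=
   limn_einf (fun n =>
     expected_utility X P U g c t i (stop_min tau T n)))%E.

Definition markov_stop X T h (t : R) (k : nat) (w : Omega) : \bar R :=
  ((T k w)%:E + h k (t + T k w)%R (embedded X T k w))%E.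

Definition markov_time X T h (t : R) (w : Omega) : \bar R :=
  match pselect (exists k, (markov_stop X T h t k w < (T k.+1 w)%:E)%E) with
  | left ex => markov_stop X T h t (ex_minn ex) w
  | right _ => +oo%E
  end.

(* As [S] is discrete and countable, joint measurability
   of [h k] on [0, +oo[ x S is measurability of each section [h k ^~ i]. *)
Definition markovian X T P h : Prop :=
  [/\ forall k t i, 0 <= t -> (0 <= h k t i)%E,
      forall k i, measurable_fun (`[0, +oo[%classic : set R) (h k ^~ i) &
      forall i t, 0 <= t -> P i [set w | (markov_time X T h t w < +oo)%E] = 1%E].

Definition value X T P U g c t i : \bar R :=
  ereal_sup [set expected_utility X P U g c t i (markov_time X T h t)
            | h in markovian X T P].

Definition exp_utility (gamma x : R) : R := - expR (- gamma * x).

Definition expW X T P g c (gamma : R) i : \bar R :=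
  value X T P (exp_utility gamma) g c 0 i.

Definition sum_over (A : set S) (f : S -> \bar R) : \bar R :=
  (\esum_(j in A) f^\+ j - \esum_(j in A) f^\- j)%E.

(* The two expressions in the equation
   W(i) = max { stop_value, continue_value } for q_i > c gamma. *)
Definition stop_value g (gamma : R) i : \bar R := (- expR (- gamma * g i))%:E.

Definition continue_value q X T P g c (gamma : R) i : \bar R :=
  sum_over [set j | j != i] (fun j =>
    ((q i j / (rate q i - c * gamma))%:E * expW X T P g c gamma j)%E).

Definition maximizer q X T P g c (gamma : R) i : \bar R :=
  if (rate q i <= c * gamma) ||
     (Order.max (stop_value g gamma i) (continue_value q X T P g c gamma i)
        == stop_value g gamma i)
  then 0%E else +oo%E.

Definition stop_set q g c (gamma : R) : set S :=
  [set i | ((expR (- gamma * g i))%:E <=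
             \esum_(j in [set j | j != i])
               (q i j / (rate q i - c * gamma) * expR (- gamma * g j))%:E)%E
           /\ c * gamma < rate q i
         \/ rate q i <= c * gamma].

End chain.

(* Main.v *)
Require Import Defs.
From HB Require Import structures.
From mathcomp Require Import all_boot all_order all_algebra.
From mathcomp Require Import all_classical all_reals all_analysis.
From mathcomp Require Import measurable_realfun.
From mathcomp Require Import ring lra.

Import Order.TTheory GRing.Theory Num.Theory.
Import numFieldNormedType.Exports.

(** Write [lam = c * gamma] and [a j = expR (- gamma * g j)].  The expected
    utility of stopping at [tau] is [- E_i (a (X_tau) * expR (lam * tau))], so
    [- W i] is the least expected cost over the Markovian times.  Stopping at
    once costs [a i], hence [- a j <= W j <= 0] everywhere ([expW_ge],
    [expW_le0]).

    Let [i] be in the stop set.  Freeze a Markovian time [tau] at the jump times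
    and let [M_n] ([stopped_cost]) be the cost incurred at [tau /\ S_n].  If
    [tau] has not occurred before [S_n] and [Z_n = j], the rule waits for a time
    [H] which is a function of [S_n] and [j]; given the history, the sojourn in [j] is
    exponential of rate [q_j] and independent of the next state, so that the
    expected cost after one more sojourn, relative to [expR (lam * S_n)], is an
    explicit integral.
    - If [lam < q_j] it equals [(1 - s) * B + s * a j], where [s] lies in [0, 1]
      and [B = \sum_(l != j) q_jl / (q_j - lam) * a l]; the stop set is defined
      by [a j <= B].
    - If [q_j <= lam] discounting grows at least as fast as the sojourn tail
      decays, and waiting never pays.
    Thus one step does not decrease the cost from a state of the stop set
    ([one_step_ge]).  The chain never leaves that set, which is closed under
    jumps ([embedded_closed]), so [E_i M_n] is nondecreasing in [n]
    ([integral_stopped_cost_le]) and stays above [E_i M_0 = a i].  Assumption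
    (A2) carries the bound over to [tau], and [W i = - a i] ([expW_stop_set]).

    (A2) concerns stopping times of the natural filtration, so a Markovian time
    has to be recognised as one ([markov_time_stopping]): since paths are right
    continuous and piecewise constant, [S_n <= t] can be read off from the
    positions at rational times up to [t] and at [t] itself ([time_succ_le]).
    The conditional law of the next sojourn comes from the finite-dimensional
    laws of the chain by a pi-lambda argument ([markov_property]) and is put in
    integral form with Fubini's theorem ([integral_markov_property]).

    The maximizer is then read off for [lam < q_i].  In the stop set the
    continuation value is [- B], at most [- a i], because the successors of [i]
    are in the stop set too and have [W = - a].  Outside it, [W >= - a] makes the continuation value
    at least [- B], which exceeds [- a i].  A rule that waits for ever outside a
    set and stops at once inside it stops at the hitting time of the set
    ([markov_time_hitting]). *)

Set Implicit Arguments.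
Unset Strict Implicit.
Unset Printing Implicit Defensive.

Local Open Scope classical_set_scope.
Local Open Scope ring_scope.

(** * Integration along a countable partition *)

Lemma measurable_fibers d d' (O : measurableType d) (Y : measurableType d')
    (S : countType) (Z : O -> S) (F : S -> O -> Y) (D : set O) :
  measurable D -> (forall j, measurable [set w | Z w = j]) ->
  (forall j, measurable_fun D (F j)) ->
  measurable_fun D (fun w => F (Z w) w).
Proof.
move=> mD mZ mF _ B mB.
rewrite (_ : _ `&` _ =
  \bigcup_(j : S) ([set w | Z w = j] `&` (D `&` F j @^-1` B))).
  apply: countable_bigcupT_measurable => // j; apply: measurableI => //.
  exact: mF.
by apply/seteqP; split=> [w [Dw Bw]|w [j _ [<- [Dw Bw]]]]; [exists (Z w)|].
Qed.

Lemma limn_einf_le (R : realType) (u : (\bar R)^nat) (l : \bar R) :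
  (forall n, u n <= l)%E -> (limn_einf u <= l)%E.
Proof.
move=> ul; rewrite limn_einf_lim; apply: lime_le; first exact: is_cvg_einfs.
apply: nearW => n; apply: le_trans (ul n).
by apply: ereal_inf_lbound; exists n => /=.
Qed.

Section countable_sums.
Context {R : realType} {S : countType}.
Local Open Scope ereal_scope.

(** Sums over a countable type are turned into series, for which exchange with
    the integral is a monotone convergence statement. *)
Lemma esum_pickle_inv (f : S -> \bar R) : (forall j, 0 <= f j) ->
  (\esum_(j in [set: S]) f j) =
  \sum_(k <oo) (if @pickle_inv S k is Some j then f j else 0).
Proof.
move=> f0; pose a k := if @pickle_inv S k is Some j then f j else 0.
have a0 k : 0 <= a k by rewrite /a; case: pickle_inv.
rewrite nneseries_esumT //.
transitivity (\esum_(k in range (@pickle S)) a k).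
  rewrite esum_image; last by move=> x y _ _; exact: (pcan_inj (@pickleK _)).
  by apply: eq_esum => j _; rewrite /a pickleK_inv.
rewrite esum_mkcond; apply: eq_esum => k _.
case: ifPn => // /negP; rewrite inE => nk.
have := @pickle_invK S k; case E: pickle_inv => [j|//] /= jk.
by exfalso; apply: nk; exists j.
Qed.

Lemma esumZ (D : set S) (x : R) (f : S -> \bar R) :
  (0 <= x)%R -> (forall j, 0 <= f j) ->
  \esum_(j in D) (x%:E * f j) = x%:E * \esum_(j in D) f j.
Proof.
move=> x0 f0; rewrite esum_mkcond [in RHS]esum_mkcond.
pose f1 j := if j \in D then f j else 0.
have f10 j : 0 <= f1 j by rewrite /f1; case: ifP.
rewrite (eq_esum (b := fun j => x%:E * f1 j)); last first.
  by move=> j _; rewrite /f1; case: ifP => // _; rewrite mule0.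
rewrite esum_pickle_inv; last by move=> j; rewrite mule_ge0 // lee_fin.
rewrite esum_pickle_inv // -nneseriesZl; last by move=> k _; case: pickle_inv.
by apply: eq_eseriesr => k _; case: pickle_inv => //; rewrite mule0.
Qed.

Lemma integral_esum d (T : measurableType d) (mu : {measure set T -> \bar R})
    (D : set T) (f : S -> T -> \bar R) :
  measurable D -> (forall j, measurable_fun D (f j)) ->
  (forall j x, D x -> 0 <= f j x) ->
  \int[mu]_(x in D) (\esum_(j in [set: S]) f j x) =
  \esum_(j in [set: S]) \int[mu]_(x in D) f j x.
Proof.
move=> mD mf f0.
rewrite esum_pickle_inv; last by move=> j; apply: integral_ge0 => x; exact: f0.
pose a k x := if @pickle_inv S k is Some j then f j x else 0.
transitivity (\int[mu]_(x in D) \sum_(k <oo) a k x).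
  apply: eq_integral => x /set_mem Dx.
  by rewrite esum_pickle_inv // => j; exact: f0.
rewrite integral_nneseries //.
- apply: eq_eseriesr => k _; rewrite /a; case: pickle_inv => //.
  exact: integral0.
- by move=> k; rewrite /a; case: pickle_inv.
- by move=> k x Dx; rewrite /a; case: pickle_inv => // j; exact: f0.
Qed.

Lemma measurable_esum d (T : measurableType d) (D : set T)
    (f : S -> T -> \bar R) :
  measurable D -> (forall j, measurable_fun D (f j)) ->
  (forall j x, D x -> 0 <= f j x) ->
  measurable_fun D (fun x => \esum_(j in [set: S]) f j x).
Proof.
move=> mD mf f0.
pose a k x := if @pickle_inv S k is Some j then f j x else 0.
apply: (eq_measurable_fun (fun x => \sum_(k <oo) a k x)).
  by move=> x /set_mem Dx; rewrite esum_pickle_inv // => j; exact: f0.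
apply: ge0_emeasurable_sum => //.
- by move=> k x Dx _; rewrite /a; case: pickle_inv => // j; exact: f0.
- by move=> k _; rewrite /a; case: pickle_inv.
Qed.

Lemma ge0_integral_fibers d (T : measurableType d)
    (mu : {measure set T -> \bar R}) (D : set T) (Z : T -> S)
    (f : T -> \bar R) :
  measurable D -> (forall j, measurable [set x | Z x = j]) ->
  measurable_fun D f -> (forall x, D x -> 0 <= f x) ->
  \int[mu]_(x in D) f x =
  \esum_(j in [set: S]) \int[mu]_(x in D `&` [set x | Z x = j]) f x.
Proof.
move=> mD mZ mf f0.
under [RHS]eq_esum do rewrite integral_mkcondr.
rewrite -integral_esum //.
- apply: eq_integral => x /set_mem Dx.
  rewrite (esumID [set Z x]) // ?setTI; last first.
    by move=> j _; rewrite patchE; case: ifPn => // _; exact: f0.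
  rewrite esum_set1 ?patchE ?mem_set ?f0 // esum1 ?adde0 // => j jZ.
  by rewrite patchE memNset //= => E; apply: jZ.
- move=> j; apply/(measurable_restrict _ _ _) => //.
  by apply: measurable_funS mf => //; exact: subIsetl.
- by move=> j x Dx; rewrite patchE; case: ifPn => // _; exact: f0.
Qed.

End countable_sums.

Section integration.
Context d (T : measurableType d) (R : realType).
Variable mu : {measure set T -> \bar R}.
Local Open Scope ereal_scope.

Lemma ge0_integral_mrestr (D : set T) (mD : measurable D) (f : T -> \bar R) :
  measurable_fun setT f -> (forall x, 0 <= f x) ->
  \int[mrestr mu mD]_x f x = \int[mu]_(x in D) f x.
Proof.
move=> mf f0; rewrite -(setUv D) ge0_integral_setU //; last 3 first.
- exact: measurableC.
- by rewrite setUv.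
- by rewrite disj_set2E setICr.
rewrite [X in X + _ = _](eq_measure_integral mu); last first.
  by move=> A _ AD; rewrite /= /mrestr (setIidl AD).
rewrite [X in _ + X = _](eq_measure_integral mzero); last first.
  by move=> A _ AD; rewrite /= /mrestr /mzero -(measure0 mu); congr (mu _);
    rewrite -subset0 => x [/AD].
by rewrite integral_measure_zero adde0.
Qed.

Lemma integral_null_set (D N : set T) (f : T -> \bar R) :
  measurable N -> mu N = 0 -> D `<=` N -> \int[mu]_(x in D) f x = 0.
Proof.
move=> mN N0 DN; rewrite (eq_measure_integral mzero) ?integral_measure_zero //.
move=> A mA AD; apply/eqP; rewrite /= /mzero eq_le measure_ge0 andbT -N0.
by rewrite le_measure ?inE //; exact: (subset_trans AD).
Qed.

Variables (p : T -> R) (nu : {measure set T -> \bar R}).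

Import HBNNSimple.

(** The integral against a measure that has a density: true for indicators by
    hypothesis, then for simple functions, then by monotone convergence. *)
Lemma ge0_integral_density (f : T -> \bar R) :
  measurable_fun setT p -> (forall x, (0 <= p x)%R) ->
  (forall A, measurable A -> nu A = \int[mu]_(x in A) (p x)%:E) ->
  measurable_fun setT f -> (forall x, 0 <= f x) ->
  \int[nu]_x f x = \int[mu]_x (f x * (p x)%:E).
Proof.
move=> mp p0 nuE mf f0; pose g := nnsfun_approx measurableT mf.
have mpE : measurable_fun setT (EFin \o p) by exact/measurable_EFinP.
have gf x : (g n x)%:E @[n --> \oo] --> f x by apply: cvg_nnsfun_approx.
transitivity (limn (fun n => \int[nu]_x (g n x)%:E)).
  rewrite -monotone_convergence //.
  - by apply: eq_integral => x _; apply/esym/cvg_lim => //; exact: gf.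
  - by move=> n; exact/measurable_EFinP.
  - by move=> n x _; rewrite lee_fin.
  - by move=> x _ m n mn; rewrite lee_fin; exact/lefP/nd_nnsfun_approx.
rewrite (_ : (fun n => _) = (fun n => \int[mu]_x ((g n x)%:E * (p x)%:E))).
  rewrite -monotone_convergence //.
  - apply: eq_integral => x _; apply/cvg_lim => //.
    exact: cvgeZr (gf x).
  - by move=> n; apply: emeasurable_funM => //; exact/measurable_EFinP.
  - by move=> n x _; rewrite mule_ge0 // lee_fin.
  - move=> x _ m n mn; apply: lee_wpmul2r => //; rewrite lee_fin //.
    exact/lefP/nd_nnsfun_approx.
apply/funext => n; rewrite integralT_nnsfun sintegralE.
transitivity (\int[mu]_x
    (\sum_(r \in range (g n)) (r * \1_(g n @^-1` [set r]) x * p x)%:E)).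
  rewrite ge0_integral_fsum //; last 2 first.
  - move=> r; apply/measurable_EFinP; apply: measurable_funM => //.
    exact: measurable_funM.
  - move=> r x _; rewrite EFinM mule_ge0 ?lee_fin // -lee_fin EFinM.
    exact: nnfun_muleindic_ge0.
  apply: eq_fsbigr => r /set_mem [t _ <-].
  have mE : measurable (g n @^-1` [set g n t]) by exact: measurable_sfunP.
  rewrite nuE // [in LHS]integral_mkcond -ge0_integralZl //; last 3 first.
  - apply/(measurable_restrictT _ mE); exact: measurable_funTS.
  - by move=> x _; apply: erestrict_ge0 => y _; rewrite lee_fin.
  - by rewrite lee_fin.
  apply: eq_integral => x _; rewrite patchE indicE.
  by case: ifPn; rewrite ?mulr1 ?mulr0 ?mul0r ?mule0 // EFinM.
apply: eq_integral => x _; rewrite [in RHS]fimfunE -fsumEFin //.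
under eq_fsbigr do rewrite EFinM.
by rewrite ge0_mule_fsuml // => r; rewrite EFinM nnfun_muleindic_ge0.
Qed.
End integration.
Arguments ge0_integral_fibers {R S d T mu D} Z {f}.

(** * Cost of one exponential sojourn *)

Section exponential.
Context {R : realType}.
Local Notation mu := (@lebesgue_measure R).

(** The positivity proof is an argument because unification cannot recover it
    from the underlying set function. *)
Definition exponential_law (r : R) (r0 : 0 < r) :
    probability (measurableTypeR R) R :=
  exponential_distribution_exponential_prob__canonical__probability_measure_Probability r0.

Lemma exponential_lawE (r : R) (r0 : 0 < r) A :
  exponential_law r0 A = exponential_prob r A.
Proof. by []. Qed.

Lemma integral_exponential_law (r : R) (r0 : 0 < r) (A : set R)
    (f : R -> \bar R) :
  measurable A -> measurable_fun setT f -> (forall u, (0 <= f u)%E) ->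
  (\int[exponential_law r0]_(u in A) f u =
   \int[mu]_(u in A) (f u * (exponential_pdf r u)%:E))%E.
Proof.
move=> mA mf f0; rewrite integral_mkcond.
rewrite (ge0_integral_density (mu := mu) (p := exponential_pdf r)) //.
- rewrite [RHS]integral_mkcond; apply: eq_integral => u _.
  by rewrite !patchE; case: ifPn => //; rewrite mul0e.
- exact: measurable_exponential_pdf.
- by move=> u; apply: exponential_pdf_ge0; exact: ltW.
- apply/(measurable_restrictT _ mA); exact: measurable_funTS.
- by move=> u; rewrite patchE; case: ifPn.
Qed.

Definition before (H : \bar R) : set R := [set u | (u%:E <= H)%E].

Lemma measurable_before H : measurable (before H).
Proof.
case: H => [h| |]; rewrite /before.
- rewrite (_ : [set _ | _] = `]-oo, h]%classic); first exact: measurable_itv.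
  by apply/seteqP; split => u /=; rewrite in_itv /= lee_fin.
- rewrite (_ : [set _ | _] = setT) //.
  by apply/seteqP; split => // u _ /=; rewrite leey.
- rewrite (_ : [set _ | _] = set0) //.
  by apply/seteqP; split => // u /=; rewrite leeNy_eq.
Qed.

(** The probability that an exponential variable of rate [r] exceeds [H >= 0]. *)
Definition survival (r : R) (H : \bar R) : R :=
  if H is h%:E then expR (- r * h) else 0.

Lemma survival_ge0 r H : 0 <= survival r H.
Proof. by case: H => [h| |] //=; exact: expR_ge0. Qed.

Lemma survival_le1 r H : 0 < r -> (0 <= H)%E -> survival r H <= 1.
Proof.
move=> r0; case: H => [h| |] //=; rewrite lee_fin => h0.
by rewrite -expR0 ler_expR mulNr oppr_le0 mulr_ge0 // ltW.
Qed.

Lemma exponential_before (r : R) (r0 : 0 < r) H : (0 <= H)%E ->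
  exponential_law r0 (before H) = (1 - survival r H)%:E.
Proof.
case: H => [h h0| _|//] /=; last first.
  rewrite subr0 (_ : before _ = setT) ?probability_setT //.
  by apply/seteqP; split => // u _; rewrite /before /= leey.
transitivity (exponential_prob r `[0, h]).
  rewrite /exponential_prob integral_mkcond.
  rewrite [RHS]integral_mkcond; apply: eq_integral => u _; rewrite !patchE.
  (* the density vanishes on the negative times that [before h] contains *)
  rewrite (_ : (u \in `[0, h]%classic) = (0 <= u) && (u \in before h%:E)).
    case: ifPn; case: leP => //= u0 _; rewrite lt0_exponential_pdf //.
  apply/idP/andP => [|[u0]]; rewrite !inE /= in_itv /= /before /= lee_fin.
    by move=> /andP[].
  by rewrite u0.
move: h0; rewrite lee_fin le_eqVlt => /predU1P[<-|h0]; last first.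
  by rewrite exponential_prob_itv0c.
rewrite set_itv1 /exponential_prob integral_set1.
by rewrite mulr0 expR0 subrr.
Qed.

Lemma exponential_after (r : R) (r0 : 0 < r) H : (0 <= H)%E ->
  exponential_law r0 (~` before H) = (survival r H)%:E.
Proof.
move=> H0; rewrite probability_setC; last exact: measurable_before.
by rewrite exponential_before // -EFinB; congr EFin; ring.
Qed.

(** Cost of a sojourn of length [u] under the deadline [H]: [x] is the terminal
    cost if the jump comes first, [y] if the deadline does.  At [H = +oo] the
    second branch is never taken. *)
Definition stage_cost (lam x y : R) (H : \bar R) (u : R) : R :=
  if (u%:E <= H)%E then x * expR (lam * u) else y * expR (lam * fine H).

Lemma stage_cost_ge0 lam x y H u :
  0 <= x -> 0 <= y -> 0 <= stage_cost lam x y H u.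
Proof.
by move=> x0 y0; rewrite /stage_cost; case: ifP; rewrite mulr_ge0 ?expR_ge0.
Qed.

Lemma measurable_exp_scale lam :
  measurable_fun setT (fun u : R => (expR (lam * u))%:E).
Proof. by apply/measurable_EFinP; apply: measurableT_comp. Qed.

Lemma measurable_stage_cost lam x y H :
  measurable_fun setT (fun u => (stage_cost lam x y H u)%:E).
Proof.
have mexp := measurable_exp_scale lam.
apply/measurable_EFinP; apply: measurable_fun_ifT => //=.
- apply: (measurable_fun_bool true); rewrite setTI.
  by rewrite (_ : _ @^-1` _ = before H) //; exact: measurable_before.
- by apply: measurable_funM => //; exact/measurable_EFinP.
Qed.

Lemma integral_stage_cost (r lam x y : R) (r0 : 0 < r) (H : \bar R) :
  0 <= x -> 0 <= y -> (0 <= H)%E ->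
  (\int[exponential_law r0]_u (stage_cost lam x y H u)%:E =
   x%:E * \int[exponential_law r0]_(u in before H) (expR (lam * u))%:E +
   (y * survival (r - lam) H)%:E)%E.
Proof.
move=> x0 y0 H0; have mB := measurable_before H.
have mexp := measurable_exp_scale lam.
have mcost := measurable_stage_cost lam x y H.
rewrite -(setUv (before H)) ge0_integral_setU //; last 4 first.
- exact: measurableC.
- by rewrite setUv.
- by move=> u _; rewrite lee_fin stage_cost_ge0.
- by rewrite disj_set2E setICr.
congr (_ + _)%E.
  rewrite -ge0_integralZl_EFin //; last first.
    exact: measurable_funTS.
  by apply: eq_integral => u /set_mem; rewrite /before /stage_cost /= => ->.
transitivity (\int[exponential_law r0]_(u in ~` before H)
    (cst (y * expR (lam * fine H))%:E) u)%E.
  apply: eq_integral => u /set_mem; rewrite /before /stage_cost /= => /negP.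
  by rewrite -ltNge => uH; rewrite leNgt uH.
rewrite integral_cst; last exact: measurableC.
rewrite [X in (_ * X)%E]exponential_after // -EFinM -mulrA; congr (_ * _)%:E.
case: H H0 {mB mcost} => [h h0| |] //=; rewrite ?mulr0 //.
by rewrite -expRD; congr expR; ring.
Qed.

(** Multiplying the exponential density of rate [r] by [expR (lam * u)] gives
    [r / (r - lam)] times the density of rate [r - lam], so that the cost is a
    convex combination whose weights do not depend on [x] and [y]. *)
Lemma integral_stage_cost_supercritical (r lam x y : R) (r0 : 0 < r)
    (H : \bar R) :
  lam < r -> 0 <= x -> 0 <= y -> (0 <= H)%E ->
  (\int[exponential_law r0]_u (stage_cost lam x y H u)%:E =
   ((1 - survival (r - lam) H) * (r / (r - lam) * x) +
    survival (r - lam) H * y)%:E)%E.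
Proof.
move=> lr x0 y0 H0; rewrite integral_stage_cost //.
have s0 : 0 < r - lam by rewrite subr_gt0.
have mexp := measurable_exp_scale lam.
have -> : (\int[exponential_law r0]_(u in before H) (expR (lam * u))%:E =
    (r / (r - lam))%:E * exponential_law s0 (before H))%E.
  rewrite integral_exponential_law //; last exact: measurable_before.
  rewrite exponential_lawE /exponential_prob -ge0_integralZl_EFin //;
    last 4 first.
  - exact: measurable_before.
  - by move=> u _; rewrite lee_fin exponential_pdf_ge0 // ltW.
  - apply/measurable_EFinP/measurable_funTS; exact: measurable_exponential_pdf.
  - by rewrite divr_ge0 // ltW.
  apply: eq_integral => u _; rewrite -!EFinM; congr EFin.
  have [u0|u0] := ltP u 0; first by rewrite !lt0_exponential_pdf // !mulr0.
  rewrite !exponential_pdfE // mulrCA -expRD [in RHS]mulrA divfK ?gt_eqF //.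
  by congr (_ * expR _); ring.
rewrite exponential_before // -!EFinM -EFinD; congr EFin; ring.
Qed.

(** With a finite deadline the event that the deadline comes first alone
    contributes [y * expR ((lam - r) * H) >= y]; with an infinite one the
    discounted density stays above [r] and the cost is infinite. *)
Lemma integral_stage_cost_subcritical (r lam x y : R) (r0 : 0 < r)
    (H : \bar R) :
  r <= lam -> 0 < x -> 0 <= y -> (0 <= H)%E ->
  (y%:E <= \int[exponential_law r0]_u (stage_cost lam x y H u)%:E)%E.
Proof.
move=> rl x0 y0 H0; rewrite integral_stage_cost //; last exact: ltW.
have I0 : (0 <= \int[exponential_law r0]_(u in before H) (expR (lam * u))%:E)%E.
  by apply: integral_ge0 => u _; rewrite lee_fin expR_ge0.
case: H H0 I0 => [h| |] // H0 I0.
  apply: (@le_trans _ _ (y * survival (r - lam) h%:E)%:E); last first.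
    by rewrite leeDr // mule_ge0 // lee_fin ltW.
  rewrite lee_fin /= ler_peMr // -expR0 ler_expR opprB mulr_ge0 ?subr_ge0 //.
rewrite (_ : integral _ _ _ = +oo%E); first by rewrite gt0_muley // addye ?leey.
apply/eqP; rewrite -leye_eq.
have mexp := measurable_exp_scale lam.
rewrite integral_exponential_law //; last exact: measurable_before.
have -> : before +oo%E = setT.
  by apply/seteqP; split => // u _; rewrite /before /= leey.
have mpdf : measurable_fun setT (fun u : R =>
    ((expR (lam * u))%:E * (exponential_pdf r u)%:E)%E).
  apply: emeasurable_funM => //; apply/measurable_EFinP.
  exact: measurable_exponential_pdf.
apply: (@le_trans _ _ (\int[mu]_(u in `[0%R, +oo[) cst r%:E u)%E).
  rewrite integral_cst //= lebesgue_measure_itv /= ltry.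
  by rewrite sube0 gt0_muley.
apply: (@le_trans _ _ (\int[mu]_(u in `[0%R, +oo[)
    ((expR (lam * u))%:E * (exponential_pdf r u)%:E))%E).
  apply: ge0_le_integral => //.
  - by move=> u _; rewrite /= lee_fin ltW.
  - exact: measurable_funTS.
  move=> u; rewrite /= in_itv /= andbT => u0; rewrite -EFinM lee_fin.
  rewrite exponential_pdfE // mulrCA -expRD ler_peMr ?(ltW r0) //.
  rewrite -expR0 ler_expR -mulrDl mulr_ge0 //; lra.
apply: ge0_subset_integral => // u _; rewrite mule_ge0 // lee_fin ?expR_ge0 //.
exact/exponential_pdf_ge0/ltW.
Qed.

End exponential.

(** * The jump chain and the natural filtration *)

Lemma measurable_fun_sublevel d (O : measurableType d) (R : realType)
    (f : O -> R) :
  (forall x, measurable [set w | f w <= x]) -> measurable_fun setT f.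
Proof.
move=> mf; apply: (measurability _ (RGenOInfty.measurableE R)) => //.
move=> _ [_ [x ->] <-]; rewrite setTI.
rewrite (_ : _ @^-1` _ = ~` [set w | f w <= x]); first exact: measurableC.
by apply/seteqP; split => w /=; rewrite in_itv /= andbT ltNge => /negP.
Qed.

Section markovian_rule.
Context {d : measure_display} {O : measurableType d} {R : realType}
  {S : countType}.
Variables (T : nat -> O -> R) (Z : nat -> O -> S) (h : nat -> R -> S -> \bar R).
Hypothesis mh : forall k j, measurable_fun setT (h k ^~ j).
Local Open Scope ereal_scope.

(** [planned_stop k] is the date at which the rule stops if no jump comes first,
    and [unstopped n] says that the first [n] jumps all came first.  The jump
    times and states are parameters because the same measurability statements
    are needed for the full sigma-algebra, for the past at a fixed time (with
    truncated times) and for the history at a jump time. *)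
Definition planned_stop k w : \bar R := (T k w)%:E + h k (T k w) (Z k w).

Definition unstopped n w :=
  forall k, (k < n)%N -> (T k.+1 w)%:E <= planned_stop k w.

Lemma measurable_planned_stop k :
  measurable_fun setT (T k) -> (forall j, measurable [set w | Z k w = j]) ->
  measurable_fun setT (planned_stop k).
Proof.
move=> mT mZ; apply: emeasurable_funD; first exact/measurable_EFinP.
apply: (measurable_fibers (F := fun j w => h k (T k w) j)) => // j.
exact: (measurableT_comp (mh k j)).
Qed.

Lemma measurable_unstopped n :
  (forall k, (k <= n)%N -> measurable_fun setT (T k)) ->
  (forall k, (k < n)%N -> forall j, measurable [set w | Z k w = j]) ->
  measurable [set w | unstopped n w].
Proof.
move=> mT mZ.
rewrite (_ : [set _ | _] =
    \bigcap_(k in [set k | (k < n)%N])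
      [set w | (T k.+1 w)%:E <= planned_stop k w]).
  apply: bigcap_measurableType => k /= kn.
  rewrite -[X in measurable X]setTI; apply: measurable_lee => //.
    by apply/measurable_EFinP; exact: mT.
  by apply: measurable_planned_stop; [exact/mT/ltnW|exact: mZ].
by apply/seteqP; split.
Qed.

End markovian_rule.

Section chain_paths.
Context {d : measure_display} {Omega : measurableType d} {R : realType}
  {S : countType} {q : S -> S -> R} {X : R -> Omega -> S}
  {T : nat -> Omega -> R} {P : S -> probability Omega R}.
Hypothesis hX : markov_chain q X T P.
Local Notation Z := (embedded X T).

Lemma time_mono w m n : (m <= n)%N -> T m w <= T n w.
Proof.
move=> /subnK <-; elim: (n - m)%N => // k IH; rewrite addSn.
exact/(le_trans IH)/ltW/(chain_time_lt hX).
Qed.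

Lemma time_ge0 n w : 0 <= T n w.
Proof. by rewrite -(chain_time0 hX w) time_mono. Qed.

Lemma path_at n t w : T n w <= t < T n.+1 w -> X t w = Z n w.
Proof. exact: (chain_path hX). Qed.

(** A countable set of dates in [0, t] that contains [t]. *)
Definition grid (t : R) (o : option rat) : R :=
  if o is Some r
  then if (0 <= ratr r :> R) && (ratr r <= t) then ratr r else t
  else t.

Lemma grid_itv t p : 0 <= t -> 0 <= grid t p <= t.
Proof.
by move=> t0; case: p => [r|] /=; [case: ifP|]; rewrite ?t0 ?lexx.
Qed.

(** Sojourn intervals are closed on the left only, which is why [t] itself is
    put in the grid: a jump may occur exactly at [t]. *)
Lemma grid_sojourn t n w : T n w <= t ->
  exists p, T n w <= grid t p < T n.+1 w.
Proof.
have lt := chain_time_lt hX n w.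
rewrite le_eqVlt => /predU1P[<-|nt]; first by exists None; rewrite /= lexx lt.
have : T n w < Num.min t (T n.+1 w) by rewrite lt_min nt lt.
move=> /rat_in_itvoo[r]; rewrite in_itv /= lt_min => /and3P[nr rt rn].
exists (Some r); rewrite /= (le_trans (time_ge0 n w) (ltW nr)) (ltW rt) /=.
by rewrite (ltW nr) rn.
Qed.

(** Successive embedded states differ, so every jump is visible at the grid
    dates, and no change of state is visible without one. *)
Lemma time_succ_le n t w : 0 <= t ->
  T n.+1 w <= t <-> exists p p', [/\ T n w <= grid t p,
    grid t p <= grid t p' & X (grid t p) w <> X (grid t p') w].
Proof.
move=> t0; split => [nt|[p [p' [no pp' XX]]]].
  have nt' := le_trans (ltW (chain_time_lt hX n w)) nt.
  have [p ho] := grid_sojourn nt'; have [p' ho'] := grid_sojourn nt.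
  exists p, p'; have /andP[no on] := ho; have /andP[np' _] := ho'; split => //.
    by rewrite ltW // (lt_le_trans on).
  rewrite (path_at ho) (path_at ho') => /esym; exact: (chain_jump hX).
have /andP[_ ut] := grid_itv p' t0.
apply: le_trans ut; rewrite leNgt; apply/negP => on; apply: XX.
rewrite (@path_at n) ?(@path_at n) ?no ?(le_trans no) //.
by rewrite (le_lt_trans pp').
Qed.

Lemma filtration_subset s t : s <= t ->
  natural_filtration X s `<=` natural_filtration X t.
Proof.
move=> st; apply: smallest_sub; first exact: smallest_sigma_algebra.
move=> A [r [i [/andP[r0 rs] ->]]]; apply: sub_sigma_algebra.
by exists r, i; rewrite r0 (le_trans rs).
Qed.

Lemma filtration_measurable t : natural_filtration X t `<=` measurable.
Proof.
apply: smallest_sub; first exact: sigma_algebra_measurable.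
by move=> A [r [i [/andP[r0 rs] ->]]]; exact: (chain_measurable hX).
Qed.

Lemma filtration_state s t i : 0 <= s <= t ->
  natural_filtration X t [set w | X s w = i].
Proof. by move=> st; apply: sub_sigma_algebra; exists s, i. Qed.

Definition past t := g_sigma_algebraType
  [set A | exists r i, 0 <= r <= t /\ A = [set w | X r w = i]].

Lemma filtration_time n t : 0 <= t ->
  natural_filtration X t [set w | T n w <= t].
Proof.
elim: n t => [t t0|n IH t t0].
  rewrite (_ : [set _ | _] = setT); first exact: (@measurableT _ (past t)).
  by apply/seteqP; split => // w _ /=; rewrite (chain_time0 hX).
rewrite (_ : [set _ | _] = \bigcup_(oo : option rat * option rat)
  ([set w | T n w <= grid t oo.1] `&`
   (if grid t oo.1 <= grid t oo.2
    then \bigcup_(i : S) ([set w | X (grid t oo.1) w = i] `&`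
                           ~` [set w | X (grid t oo.2) w = i])
    else set0))); last first.
  apply/seteqP; split => w /=.
    move=> /(time_succ_le n w t0)[p [p' [no pp' XX]]].
    exists (p, p') => //; split => //=; rewrite pp'.
    by exists (X (grid t p) w) => //; split => //= /esym.
  move=> [[p p'] _ [/= no]]; case: ifP => // pp' [i _ [/= <- XX]].
  by apply/(time_succ_le n w t0); exists p, p'; split => // /esym.
apply: (@countable_bigcupT_measurable _ (past t)) => // -[p p'] /=.
have /andP[u0 ut] := grid_itv p t0; have ht := grid_itv p' t0.
apply: (@measurableI _ (past t)).
  by apply: (filtration_subset ut); exact: IH.
case: ifP => _; last exact: (@measurable0 _ (past t)).
apply: (@countable_bigcupT_measurable _ (past t)) => // i.
apply: (@measurableI _ (past t)).
  by apply: filtration_state; rewrite u0.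
by apply: (@measurableC _ (past t)); exact: filtration_state.
Qed.

(** Jump times and states as seen by an observer at time [t].  On [T n w <= t]
    they are the true ones, elsewhere they are [t] and the state at [t]; they are
    measurable for the past at [t]. *)
Definition time_upto t n (w : past t) : R := Num.min (T n w) t.
Definition state_upto t n (w : past t) : S := X (time_upto n w) w.

Lemma measurable_time_upto t n : 0 <= t ->
  measurable_fun setT (@time_upto t n).
Proof.
move=> t0; apply: measurable_fun_sublevel => x; rewrite /time_upto.
have [tx|xt] := leP t x.
  rewrite [X in measurable X](_ : _ = setT);
    first exact: (@measurableT _ (past t)).
  by apply/seteqP; split => // w _ /=; rewrite ge_min tx orbT.
have [x0|x0] := leP 0 x.
  apply: (filtration_subset (ltW xt)).
  rewrite (_ : (fun _ => is_true _) = [set w | T n w <= x]);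
    first exact: filtration_time.
  by apply/seteqP; split => w /=; rewrite ge_min (leNgt t) xt orbF.
rewrite [X in measurable X](_ : _ = set0);
  first exact: (@measurable0 _ (past t)).
apply/seteqP; split => // w /=; rewrite ge_min (leNgt t) xt orbF.
by move=> /le_lt_trans/(_ x0); rewrite ltNge time_ge0.
Qed.

Lemma measurable_state_upto t n j : 0 <= t ->
  measurable [set w : past t | state_upto n w = j].
Proof.
move=> t0.
rewrite [X in measurable X](_ : _ =
  (~` [set w | T n w <= t] `&` [set w | X t w = j]) `|`
  \bigcup_(p : option rat) ([set w | T n w <= grid t p] `&`
    ~` [set w | T n.+1 w <= grid t p] `&` [set w | X (grid t p) w = j])).
  apply: measurableU.
    apply: measurableI; last by apply: filtration_state; rewrite t0 lexx.
    by apply: measurableC; exact: filtration_time.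
  apply: countable_bigcupT_measurable => // p.
  have /andP[u0 ut] := grid_itv p t0.
  apply: measurableI; last by apply: filtration_state; rewrite u0.
  apply: measurableI.
    by apply: (filtration_subset ut); exact: filtration_time.
  by apply: measurableC; apply: (filtration_subset ut); exact: filtration_time.
rewrite /state_upto /time_upto; apply/seteqP; split => w /=.
  have [nt Xj|tn Xj] := leP (T n w) t; last first.
    by left; split => //; apply/negP; rewrite -ltNge.
  right; have [p /andP[no on]] := grid_sojourn nt; exists p => //=.
  split; first by split => //; apply/negP; rewrite -ltNge.
  by rewrite (@path_at n) ?no.
move=> [[/negP]|[p _ [[/= no /negP]]]]; rewrite -ltNge.
  by move=> tn <-; rewrite min_r // ltW.
move=> on <-; have /andP[u0 ut] := grid_itv p t0.
rewrite min_l ?(le_trans no) //.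
by rewrite (@path_at n (grid t p)) ?no.
Qed.

Lemma measurable_time n : measurable_fun setT (T n).
Proof.
apply: measurable_fun_sublevel => x; have [x0|x0] := leP 0 x.
  by apply: (@filtration_measurable x); exact: filtration_time.
rewrite (_ : [set _ | _] = set0) //; apply/seteqP; split => // w /=.
by move=> /le_lt_trans/(_ x0); rewrite ltNge time_ge0.
Qed.

Lemma measurable_embedded n j : measurable [set w | Z n w = j].
Proof.
rewrite (_ : [set _ | _] = \bigcup_N
  ([set w | T n w <= N%:R] `&` [set w | @state_upto N%:R n w = j])).
  apply: bigcupT_measurable => N; apply: measurableI.
    by apply: (@filtration_measurable N%:R); exact: filtration_time.
  by apply: (@filtration_measurable N%:R); exact: measurable_state_upto.
apply/seteqP; split => w /=; rewrite /state_upto /time_upto.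
  move=> <-; have [N TN] : exists N : nat, T n w <= N%:R.
    exists (Num.truncn (T n w)).+1; exact/ltW/truncnS_gt.
  by exists N => //=; split => //; rewrite min_l.
by move=> [N _ [/= TN]]; rewrite min_l.
Qed.

End chain_paths.

Arguments past {d Omega R S} X t.
Arguments time_upto {d Omega R S} X T t n.
Arguments state_upto {d Omega R S} X T t n.

(** * Markovian times are stopping times *)

Section markov_times.
Context {d : measure_display} {Omega : measurableType d} {R : realType}
  {S : countType} {q : S -> S -> R} {X : R -> Omega -> S}
  {T : nat -> Omega -> R} {P : S -> probability Omega R}.
Hypothesis hX : markov_chain q X T P.
Variable h : nat -> R -> S -> \bar R.
Hypothesis hh : markovian X T P h.
Local Notation Z := (embedded X T).
Local Notation tau := (markov_time X T h 0).
Local Open Scope ereal_scope.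

(** A rule is only known to be measurable and nonnegative at nonnegative dates;
    clamping the date gives a rule with both properties everywhere that acts in
    the same way on the jump times. *)
Definition pos_rule k (s : R) j := h k (Num.max 0%R s) j.

Lemma pos_rule_ge0 k s j : 0 <= pos_rule k s j.
Proof. by case: hh => h0 _ _; apply: h0; rewrite le_max lexx. Qed.

Lemma measurable_pos_rule k j : measurable_fun setT (pos_rule k ^~ j).
Proof.
case: hh => _ mh _.
have /= := measurable_comp (g := fun s : R => Num.max 0%R s) (E := setT)
  _ _ (mh k j); apply => //.
  by move=> _ [s _ <-] /=; rewrite in_itv /= andbT le_max lexx.
exact: measurable_maxr.
Qed.

Local Notation plan := (planned_stop T Z pos_rule).
Local Notation alive := (unstopped T Z pos_rule).

Lemma markov_stopE k w : markov_stop X T h 0 k w = plan k w.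
Proof.
by rewrite /markov_stop /planned_stop /pos_rule add0r max_r // (time_ge0 hX).
Qed.

Lemma planned_stop_ge k w : (T k w)%:E <= plan k w.
Proof. by rewrite leeDl // pos_rule_ge0. Qed.

Lemma markov_time_stop k w :
  alive k w -> plan k w < (T k.+1 w)%:E -> tau w = plan k w.
Proof.
move=> uk ck; rewrite /markov_time; case: pselect => [e|[]]; last first.
  by exists k; rewrite markov_stopE.
case: ex_minnP => m; rewrite !markov_stopE => cm min.
suff -> : m = k by [].
apply/eqP; rewrite eqn_leq min ?markov_stopE //= leqNgt; apply/negP => mk.
by have := uk m mk; rewrite leNgt cm.
Qed.

Lemma markov_time_never w : (forall n, alive n w) -> tau w = +oo.
Proof.
move=> u; rewrite /markov_time; case: pselect => // e; exfalso.
by have [k] := e; rewrite markov_stopE ltNge (u k.+1).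
Qed.

Lemma markov_time_cases w :
  (exists2 k, alive k w & plan k w < (T k.+1 w)%:E) \/
  (forall n, alive n w).
Proof.
have [ex|nk] := pselect (exists k, plan k w < (T k.+1 w)%:E).
  left; case: (ex_minnP ex) => m cm min.
  exists m => // l lm; rewrite leNgt; apply/negP => /min.
  by rewrite leqNgt lm.
by right=> n k _; rewrite leNgt; apply/negP => ck; apply: nk; exists k.
Qed.

Lemma unstoppedP n w : alive n w <-> (T n w)%:E <= tau w.
Proof.
have [[k uk ck]|u] := markov_time_cases w; last first.
  by rewrite (markov_time_never u) leey; split.
rewrite (markov_time_stop uk ck); split => [un|].
  rewrite (le_trans _ (planned_stop_ge k w)) // lee_fin (time_mono hX) //.
  by rewrite leqNgt; apply/negP => kn; have := un k kn; rewrite leNgt ck.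
move=> nk l ln; apply: uk; rewrite ltnNge; apply/negP => kl.
have kn : (T k.+1 w)%:E <= (T n w)%:E.
  by rewrite lee_fin (time_mono hX) // (leq_ltn_trans kl ln).
by have := lt_le_trans ck kn; rewrite ltNge nk.
Qed.

Lemma markov_time_ge0 w : 0 <= tau w.
Proof.
have u0 : alive 0 w by [].
by move/unstoppedP : u0; rewrite (chain_time0 hX).
Qed.

Lemma markov_time_leP t w : (0 <= t)%R ->
  tau w <= t%:E <-> exists k, [/\ (T k w <= t)%R, alive k w,
    plan k w <= t%:E & plan k w < (T k.+1 w)%:E].
Proof.
move=> t0; split => [|[k [kt uk ckt ck]]];
  last by rewrite (markov_time_stop uk).
have [[k uk ck]|u] := markov_time_cases w; last first.
  by rewrite (markov_time_never u) leye_eq.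
rewrite (markov_time_stop uk ck) => ckt; exists k; split => //.
by rewrite -lee_fin (le_trans (planned_stop_ge k w)).
Qed.

(** Given [T k <= t], whether the rule stops in the [k]-th sojourn by time [t]
    depends only on the first [k] jumps and on whether the next jump precedes
    the planned stop; a next jump after [t] does so automatically.  All of this
    is visible in the truncated times and states. *)
Lemma markov_time_stopping : stopping_time X P tau.
Proof.
split; [exact: markov_time_ge0| |by case: hh => _ _ ft i; exact: ft].
move=> t t0.
pose T' k := time_upto X T t k.
pose Z' k := state_upto X T t k.
have mT' k : measurable_fun setT (T' k) by exact: (measurable_time_upto hX).
have mZ' k j : measurable [set w | Z' k w = j].
  exact: (measurable_state_upto hX).
have mc k : measurable_fun setT (planned_stop T' Z' pos_rule k).
  by apply: measurable_planned_stop => //; exact: measurable_pos_rule.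
rewrite (_ : [set w | _ <= _] = \bigcup_k
  ([set w : past X t | T k w <= t]%R `&`
   [set w | unstopped T' Z' pos_rule k w] `&`
   [set w | planned_stop T' Z' pos_rule k w <= t%:E] `&`
   (~` [set w | T k.+1 w <= t]%R `|`
    [set w | planned_stop T' Z' pos_rule k w < (T' k.+1 w)%:E]))).
  apply: (@bigcupT_measurable _ (past X t)) => k.
  apply: measurableI; last first.
    apply: measurableU.
      by apply: measurableC; exact: (filtration_time hX).
    rewrite -[X in measurable X]setTI; apply: measurable_lte => //.
    exact/measurable_EFinP.
  apply: measurableI; last first.
    rewrite -[X in measurable X]setTI.
    by apply: emeasurable_fun_infty_c => //; exact: measurableT.
  apply: measurableI; first exact: (filtration_time hX).
  by apply: measurable_unstopped => //; exact: measurable_pos_rule.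
have TE k w : (T k w <= t)%R -> T' k w = T k w.
  by move=> kt; rewrite /T' /time_upto min_l.
have cE k w : (T k w <= t)%R -> planned_stop T' Z' pos_rule k w = plan k w.
  by move=> kt; rewrite /planned_stop /Z' /state_upto -/(T' k w) TE.
have uE k w : (T k w <= t)%R ->
    unstopped T' Z' pos_rule k w <-> alive k w.
  move=> kt; split=> u l lk; have := u l lk;
  by rewrite cE ?TE // (le_trans (time_mono hX w _) kt) // ltnW.
apply/seteqP; split => w /=.
  move=> /(markov_time_leP w t0)[k [kt uk ckt ck]]; exists k => //=.
  rewrite cE //; split; first by split => //; split => //; apply/uE.
  by have [kt2|kt2] := leP (T k.+1 w) t; [right; rewrite TE|left].
move=> [k _ /= [[[kt /(uE _ _ kt) uk]]]]; rewrite cE // => ckt ck.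
apply/(markov_time_leP w t0); exists k; split => //.
have [kt'|kt'] := leP (T k.+1 w) t; last exact: le_lt_trans ckt _.
by case: ck => [[]//|]; rewrite TE.
Qed.

Variables (a : S -> R) (lam : R).

Definition stopped_cost n w : R :=
  (a (stopped X (stop_min tau T n) w) *
   expR (lam * fine (stop_min tau T n w)))%R.

Lemma stop_min_alive n w : alive n w -> stop_min tau T n w = (T n w)%:E.
Proof. by move=> /unstoppedP un; rewrite /stop_min min_r. Qed.

Lemma stopped_cost_unstopped n w : alive n w ->
  stopped_cost n w = (a (Z n w) * expR (lam * T n w))%R.
Proof. by move=> un; rewrite /stopped_cost /stopped stop_min_alive. Qed.

Lemma stopped_cost0 w : stopped_cost 0 w = a (Z 0%N w).
Proof.
rewrite stopped_cost_unstopped //.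
by rewrite (chain_time0 hX) mulr0 expR0 mulr1.
Qed.

Lemma stopped_cost_stopped n w : ~ alive n w ->
  stopped_cost n.+1 w = stopped_cost n w.
Proof.
move=> /unstoppedP/negP; rewrite -ltNge => tn; rewrite /stopped_cost /stopped.
suff -> : stop_min tau T n.+1 w = stop_min tau T n w by [].
rewrite /stop_min !min_l // ltW // (lt_trans tn) // lte_fin.
exact: (chain_time_lt hX).
Qed.

(** Together with [stopped_cost_stopped] this is a recursion that expresses
    [M_n] through the jump chain and the sojourn times only. *)
Lemma stopped_cost_step n w : alive n w ->
  stopped_cost n.+1 w =
  (expR (lam * T n w) * stage_cost lam (a (Z n.+1 w)) (a (Z n w))
     (pos_rule n (T n w) (Z n w)) (T n.+1 w - T n w))%R.
Proof.
move=> un; rewrite /stage_cost; case: ifPn => [le|].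
  have un1 : alive n.+1 w.
    move=> k; rewrite ltnS leq_eqVlt => /predU1P[->|]; last exact: un.
    by rewrite -leeBlDl // -EFinB.
  rewrite stopped_cost_unstopped // mulrCA -expRD.
  by congr (_ * expR _)%R; rewrite -mulrDr addrC subrK.
rewrite -ltNge => lt.
have cn : plan n w < (T n.+1 w)%:E by rewrite -lteBrDl // -EFinB.
have E : stop_min tau T n.+1 w = plan n w.
  by rewrite /stop_min (markov_time_stop un cn) min_l // ltW.
rewrite /stopped_cost /stopped E; move: cn lt; rewrite /planned_stop.
have := pos_rule_ge0 n (T n w) (Z n w).
case: (pos_rule n (T n w) (Z n w)) => [s s0 cn lt| |] //=.
rewrite (@path_at _ _ _ _ _ _ _ _ hX n); last first.
  by rewrite -lee_fin -lte_fin EFinD cn leeDl.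
by rewrite mulrCA -expRD -mulrDr.
Qed.

End markov_times.

(** * The Markov property at jump times *)

Section history.
Context {d : measure_display} {Omega : measurableType d} {R : realType}
  {S : countType} {q : S -> S -> R} {X : R -> Omega -> S}
  {T : nat -> Omega -> R} {P : S -> probability Omega R}.
Hypothesis hQ : intensity_matrix q.
Hypothesis hX : markov_chain q X T P.
Local Notation Z := (embedded X T).

Definition sojourn k (w : Omega) : R := T k.+1 w - T k w.

Definition path_event n (s : nat -> S) (B : nat -> set R) : set Omega :=
  [set w | (forall k, (k <= n)%N -> Z k w = s k) /\
           (forall k, (k < n)%N -> B k (sojourn k w))].

(** The empty set is added to make the family stable under intersection. *)
Definition cylinders n : set (set Omega) :=
  [set A | A = set0 \/ exists s B, (forall k, measurable (B k)) /\
                                   A = path_event n s B].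

Definition history n := g_sigma_algebraType (cylinders n).

Lemma measurable_sojourn k : measurable_fun setT (sojourn k).
Proof. by apply: measurable_funB; exact: (measurable_time hX). Qed.

Lemma measurable_path_event n s B : (forall k, measurable (B k)) ->
  measurable (path_event n s B).
Proof.
move=> mB; rewrite (_ : path_event n s B =
  (\bigcap_(k in [set k | (k <= n)%N]) [set w | Z k w = s k]) `&`
  (\bigcap_(k in [set k | (k < n)%N]) (sojourn k @^-1` B k))) //.
apply: measurableI; apply: bigcap_measurableType => k _.
  exact: (measurable_embedded hX).
by rewrite -[X in measurable X]setTI; exact: measurable_sojourn.
Qed.

Lemma cylinders_measurable n : cylinders n `<=` measurable.
Proof.
move=> A [->|[s [B [mB ->]]]]; first exact: measurable0.
exact: measurable_path_event.
Qed.

Lemma history_measurable n : <<s cylinders n >> `<=` measurable.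
Proof.
apply: smallest_sub; first exact: sigma_algebra_measurable.
exact: cylinders_measurable.
Qed.

Lemma cylinders_setI n : setI_closed (cylinders n).
Proof.
move=> A A' [->|[s [B [mB ->]]]]; first by left; rewrite set0I.
move=> [->|[s' [B' [mB' ->]]]]; first by left; rewrite setI0.
have [ss'|ss'] := pselect (forall k, (k <= n)%N -> s k = s' k).
  right; exists s, (fun k => B k `&` B' k); split.
    by move=> k; exact: measurableI.
  apply/seteqP; split => w /=.
    move=> [[Zs Bs] [Zs' Bs']]; split => // k kn; split; first exact: Bs.
    exact: Bs'.
  move=> [Zs BB]; split; split => // k kn; first by have [] := BB k kn.
    by rewrite -ss' // Zs.
  by have [] := BB k kn.
left; apply/seteqP; split => // w [[Zs _] [Zs' _]]; apply: ss' => k kn.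
by rewrite -Zs // Zs'.
Qed.

(** An event that depends on the first [n + 1] states splits along the countably
    many state sequences; [i] is only the default value of [nth]. *)
Lemma path_event_bigcup (i : S) n (A : set Omega)
    (C : (nat -> S) -> set Omega) :
  (forall w, A w <-> C (Z ^~ w) w) ->
  (forall s s' w, (forall k, (k <= n)%N -> s k = s' k) -> C s w -> C s' w) ->
  A = \bigcup_(t : seq S) (path_event n (nth i t) (fun=> setT) `&` C (nth i t)).
Proof.
move=> AC CC; apply/seteqP; split => w /=.
  move=> /AC Cw; exists (mkseq (Z ^~ w) n.+1) => //=.
  have E k : (k <= n)%N -> Z k w = nth i (mkseq (Z ^~ w) n.+1) k.
    by move=> kn; rewrite nth_mkseq.
  by split; [split|exact: CC Cw].
by move=> [t _ [[Zt _] Ct]]; apply/AC; apply: CC Ct => k kn; rewrite Zt.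
Qed.

Lemma history_embedded n k j : (k <= n)%N ->
  <<s cylinders n >> [set w | Z k w = j].
Proof.
move=> kn; rewrite (@path_event_bigcup j n [set w | Z k w = j]
  (fun s => [set w | s k = j])) //; last first.
  by move=> s s' w ss' /= <-; rewrite ss'.
apply: (@countable_bigcupT_measurable _ (history n)) => // t.
have [tk|tk] := eqVneq (nth j t k) j; last first.
  rewrite (_ : _ `&` _ = set0); first exact: (@measurable0 _ (history n)).
  by apply/seteqP; split => // w [_ /= E]; rewrite E eqxx in tk.
rewrite (_ : _ `&` _ = path_event n (nth j t) (fun=> setT)); last first.
  by apply/seteqP; split => // w [].
by apply: sub_sigma_algebra; right; exists (nth j t), (fun=> setT); split.
Qed.

Lemma history_sojourn (i : S) n k B : (k < n)%N -> measurable B ->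
  <<s cylinders n >> (sojourn k @^-1` B).
Proof.
move=> kn mB.
rewrite (@path_event_bigcup i n (sojourn k @^-1` B)
  (fun s => sojourn k @^-1` B)) //.
apply: (@countable_bigcupT_measurable _ (history n)) => // t.
apply: sub_sigma_algebra; right.
exists (nth i t), (fun l => if l == k then B else setT); split.
  by move=> l; case: ifP.
apply/seteqP; split => w /=.
  by move=> [[Zt _] Bw]; split => // l ln; case: eqP => [->|].
move=> [Zt Bw]; split; first by split.
by have := Bw k kn; rewrite eqxx.
Qed.

Lemma history_time (i : S) n k : (k <= n)%N ->
  measurable_fun (setT : set (history n)) (T k).
Proof.
elim: k => [_|k IH kn].
  rewrite (_ : T 0%N = cst 0); first exact: measurable_cst.
  by apply/funext => w; exact: (chain_time0 hX).
rewrite (_ : T k.+1 = T k \+ sojourn k); last first.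
  by apply/funext => w; rewrite /= /sojourn addrC subrK.
apply: measurable_funD; first by apply: IH; exact: ltnW.
by move=> _ B mB; rewrite setTI; exact: history_sojourn.
Qed.

Definition transition n j l : set Omega :=
  [set w | Z n w = j] `&` [set w | Z n.+1 w = l].

Lemma measurable_transition n j l : measurable (transition n j l).
Proof. by apply: measurableI; exact: (measurable_embedded hX). Qed.

Lemma jump_prob_ge0 j l : 0 <= jump_prob q j l.
Proof.
rewrite /jump_prob; case: eqVneq => // lj.
by rewrite divr_ge0 ?intensity_offdiag_ge0 // ltW // (intensity_rate_gt0 hQ).
Qed.

(** Given the history up to the [n]-th jump and the state [j] it leads to, the
    next sojourn and the next state are independent, with laws exponential and
    [jump_prob q j].  On cylinders this compares two finite-dimensional laws of
    the chain; both sides are finite measures in [A], and the cylinders form a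
    pi-system. *)
Lemma markov_property i n A j l (B : set R) :
  <<s cylinders n >> A -> measurable B ->
  P i (A `&` transition n j l `&` sojourn n @^-1` B) =
  (P i (A `&` [set w | Z n w = j]) *
   ((jump_prob q j l)%:E * exponential_law (intensity_rate_gt0 hQ j) B))%E.
Proof.
move=> hA mB; pose E := exponential_law (intensity_rate_gt0 hQ j).
have mZ : measurable [set w | Z n w = j] by exact: (measurable_embedded hX).
have mD : measurable (transition n j l `&` sojourn n @^-1` B).
  apply: measurableI; first exact: measurable_transition.
  by rewrite -[X in measurable X]setTI; exact: measurable_sojourn.
have c0 : 0 <= jump_prob q j l * fine (E B).
  by rewrite mulr_ge0 ?jump_prob_ge0 // fine_ge0.
have EB : E B = (fine (E B))%:E by rewrite fineK // fin_num_measure.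
rewrite [X in (_ * (_ * X))%E]EB -EFinM muleC -setIA.
pose g k : set Omega := if @pickle_inv (seq S) k is Some t
  then path_event n (nth i t) (fun=> setT) else set0.
have Gg k : cylinders n (g k).
  rewrite /g; case: pickle_inv => [t|]; last by left.
  by right; exists (nth i t), (fun=> setT); split.
apply: (@g_sigma_algebra_measure_unique _ _ _ (cylinders n) _ g _ _
  (mrestr (P i) mD) (mscale (NngNum c0) (mrestr (P i) mZ))) => //.
- exact: cylinders_measurable.
- apply/seteqP; split => // w _; exists (pickle (mkseq (Z ^~ w) n.+1)) => //.
  rewrite /g pickleK_inv; split => // k kn.
  by rewrite nth_mkseq.
- exact: cylinders_setI.
- move=> C [->|[s [B' [mB' ->]]]]; first by rewrite !measure0.
  rewrite /= /mscale /mrestr /=.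
  have [sj|sj] := eqVneq (s n) j; last first.
    have Zj w : path_event n s B' w -> Z n w <> j.
      by move=> [Zs _]; rewrite Zs //; exact/eqP.
    rewrite [X in P i X = _](_ : _ = set0); last first.
      by apply/seteqP; split => // w [/Zj ne [[]]].
    rewrite [X in _ = (_ * P i X)%E](_ : _ = set0) ?measure0 ?mule0 //.
    by apply/seteqP; split => // w [/Zj].
  (* the cylinder at the next jump, with [l] and [B] appended to [s] and [B'] *)
  pose s1 k := if (k <= n)%N then s k else l.
  pose B1 k := if (k < n)%N then B' k else B.
  rewrite [X in _ = (_ * P i X)%E](_ : _ = path_event n s B'); last first.
    by apply/seteqP; split => [w []//|w [Zs Bs]]; split => //=; rewrite Zs.
  rewrite [X in P i X = _](_ : _ = path_event n.+1 s1 B1); last first.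
    apply/seteqP; split => w /=.
      move=> [[Zs Bs] [[/= Zj Zl] Bn]]; split => k kn.
        rewrite /s1; case: leqP => [|nk]; first exact: Zs.
        by have -> : k = n.+1 by apply/eqP; rewrite eqn_leq kn.
      rewrite /B1; case: ltnP => [|nk]; first exact: Bs.
      by have -> : k = n by apply/eqP; rewrite eqn_leq nk andbT.
    move=> [Zs Bs]; split; [split|split; [split|]].
    - by move=> k kn; rewrite Zs ?(leq_trans kn) // /s1 kn.
    - move=> k kn; have := Bs k (ltnW kn); rewrite /B1 kn; exact.
    - by rewrite /= Zs // /s1 leqnn.
    - by rewrite /= Zs // /s1 ltnn.
    - by have := Bs n (ltnSn n); rewrite /B1 ltnn.
  have := chain_law hX i n.+1 s1 (B := B1); rewrite /path_event => -> //;
    last first.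
    by move=> k; rewrite /B1; case: ifP.
  rewrite (chain_law hX i n s mB') big_ord_recr /=.
  rewrite {1}/s1 leq0n muleA [RHS]muleC; congr (_ * _ * _)%E.
    apply: eq_bigr => k _; have kn := ltn_ord k.
    by rewrite /s1 /B1 (ltnW kn) kn.
  by rewrite /s1 /B1 leqnn !ltnn sj EFinM -EB.
- move=> k; rewrite (le_lt_trans _ (ltry 1%R)) //.
  apply: probability_le1; apply: measurableI => //.
  exact/cylinders_measurable/Gg.
Qed.

End history.

Arguments sojourn {d Omega R} T k w.
Arguments path_event {d Omega R S} X T n s B.
Arguments cylinders {d Omega R S} X T n.
Arguments history {d Omega R S} X T n.
Arguments transition {d Omega R S} X T n j l.

Section independent_pair.
Context d {O : measurableType d} {R : realType}.
Variables (mu : {measure set O -> \bar R})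
  (nu : {finite_measure set O -> \bar R}).
Local Notation R' := (measurableTypeR R).
Variables (E : probability R' R) (U V : O -> R').
Hypotheses (mU : measurable_fun setT U) (mV : measurable_fun setT V).
Hypothesis UV : forall A B : set R', measurable A -> measurable B ->
  mu (U @^-1` A `&` V @^-1` B) = (nu (U @^-1` A) * E B)%E.
Local Open Scope ereal_scope.

Let lawU : set R' -> \bar R := pushforward nu U.

HB.instance Definition _ := Measure.copy lawU
  (measure_function_pushforward__canonical__measure_function_Measure nu mU).

Let lawU_fin : fin_num_fun lawU.
Proof.
move=> A mA; apply: fin_num_measure.
by rewrite -[X in measurable X]setTI; exact: mU.
Qed.

HB.instance Definition _ := @Measure_isFinite.Build _ _ _ lawU lawU_fin.

(** The law of [(U, V)] is a product measure by uniqueness on rectangles, and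
    Fubini's theorem applies.  The two measures [mu] and [nu] differ because
    conditioning on the next state takes place in [mu] only. *)
Lemma integral_independent_pair (phi : R' -> R' -> \bar R) :
  measurable_fun setT (fun z : R' * R' => phi z.1 z.2) ->
  (forall t u, 0 <= phi t u) ->
  \int[mu]_w phi (U w) (V w) = \int[nu]_w (\int[E]_u phi (U w) u).
Proof.
move=> mphi phi0.
have mW : measurable_fun setT (fun w => (U w, V w)).
  exact: measurable_fun_pair.
pose m' : {measure set (R' * R') -> \bar R} :=
  measure_function_pushforward__canonical__measure_function_Measure mu mW.
have lawE A : measurable A -> (lawU \x E) A = m' A.
  by apply: product_measure_unique => B C mB mC; rewrite -UV.
transitivity (\int[m']_z phi z.1 z.2).
  by rewrite (ge0_integral_pushforward mW) //= preimage_setT.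
rewrite (eq_measure_integral (lawU \x E)); last first.
  by move=> A mA _; exact/esym/lawE.
rewrite fubini_tonelli1 //= (ge0_integral_pushforward mU) ?preimage_setT //.
- exact: measurable_fun_fubini_tonelli_F.
- by move=> t _; exact: integral_ge0.
Qed.

End independent_pair.

Section jump_law.
Context {d : measure_display} {Omega : measurableType d} {R : realType}
  {S : countType} {q : S -> S -> R} {X : R -> Omega -> S}
  {T : nat -> Omega -> R} {P : S -> probability Omega R}.
Hypothesis hQ : intensity_matrix q.
Hypothesis hX : markov_chain q X T P.
Local Notation Z := (embedded X T).
Local Open Scope ereal_scope.

Lemma integral_markov_property i n A j l (phi : R -> R -> \bar R) :
  <<s cylinders X T n >> A ->
  measurable_fun setT (fun z : R * R => phi z.1 z.2) ->
  (forall t u, 0 <= phi t u) ->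
  \int[P i]_(w in A `&` transition X T n j l) phi (T n w) (sojourn T n w) =
  (jump_prob q j l)%:E * \int[P i]_(w in A `&` [set w | Z n w = j])
    \int[exponential_law (intensity_rate_gt0 hQ j)]_u phi (T n w) u.
Proof.
move=> hA mphi phi0; set E := exponential_law _.
have mT := measurable_time hX n; have mD := measurable_sojourn hX n.
have mA := history_measurable hX hA.
have mAt : measurable (A `&` transition X T n j l).
  by apply: measurableI => //; exact: (measurable_transition hX).
have mAZ : measurable (A `&` [set w | Z n w = j]).
  by apply: measurableI => //; exact: (measurable_embedded hX).
have mphiTD : measurable_fun setT (fun w => phi (T n w) (sojourn T n w)).
  exact: (measurableT_comp mphi (measurable_fun_pair mT mD)).
have mF : measurable_fun setT (fun t => \int[E]_u phi t u).
  exact: (measurable_fun_fubini_tonelli_F (m2 := E)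
    (fun z : R * R => phi z.1 z.2)).
have mFT := measurableT_comp mF mT.
have p0 := jump_prob_ge0 hQ j l.
rewrite -(ge0_integral_mrestr _ mAt) //.
rewrite -(ge0_integral_mrestr _ mAZ) //; last first.
  by move=> w; exact: integral_ge0.
rewrite (@integral_independent_pair _ _ _ (mrestr (P i) mAt)
  (mscale (NngNum p0) (mrestr (P i) mAZ)) E (T n) (sojourn T n)) //.
  rewrite ge0_integral_mscale // => w _; exact: integral_ge0.
move=> B C mB mC; rewrite /= /mscale /mrestr /=.
have hT : <<s cylinders X T n >> (A `&` T n @^-1` B).
  apply: (@measurableI _ (history X T n)) => //.
  rewrite -[X in measurable X]setTI.
  exact: (history_time hX j (leqnn n)).
have := markov_property hQ hX i j l hT mC; rewrite -/E.
rewrite (_ : _ `&` _ = T n @^-1` B `&` sojourn T n @^-1` C `&`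
  (A `&` transition X T n j l)) => [->|]; last first.
  by apply/seteqP; split => w /=; tauto.
have -> : mrestr (P i) mAZ (T n @^-1` B) =
    P i (A `&` T n @^-1` B `&` [set w | Z n w = j]).
  by congr (P i _); apply/seteqP; split => w /=; tauto.
by rewrite muleCA muleA.
Qed.

End jump_law.

(** * The cost does not decrease in the stop set *)

Section one_step.
Context {R : realType} {S : countType} {q : S -> S -> R}.
Hypothesis hQ : intensity_matrix q.
Variables (a : S -> R) (lam : R).
Hypothesis a_gt0 : forall j, 0 < a j.

(** Stopping at once is no worse than stopping after one jump. *)
Definition subinvariant j := rate q j <= lam \/ lam < rate q j /\
  ((a j)%:E <= \esum_(l in [set l | l != j])
                 (q j l / (rate q j - lam) * a l)%:E)%E.

Local Open Scope ereal_scope.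

Lemma esum_jump_prob j (f : S -> R) :
  \esum_(l in [set: S]) (jump_prob q j l * f l)%:E =
  \esum_(l in [set l | l != j]) (q j l / rate q j * f l)%:E.
Proof.
rewrite [RHS]esum_mkcond; apply: eq_esum => l _; rewrite /jump_prob.
have [->|lj] := eqVneq l j; first by rewrite mul0r memNset //= eqxx.
by rewrite mem_set.
Qed.

Lemma esum_jump_prob1 j : \esum_(l in [set: S]) (jump_prob q j l)%:E = 1.
Proof.
transitivity (\esum_(l in [set: S]) (jump_prob q j l * 1)%:E).
  by apply: eq_esum => l _; rewrite mulr1.
have r0 := intensity_rate_gt0 hQ j.
rewrite esum_jump_prob (_ : 1 = ((rate q j)^-1)%:E * (rate q j)%:E); last first.
  by rewrite -EFinM mulVf // gt_eqF.
rewrite -(intensity_rowsum hQ) esum_mkcond [X in _ * X]esum_mkcond.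
rewrite -esumZ; first last.
- move=> l; case: ifPn => //; rewrite inE /= => lj.
  by rewrite lee_fin (intensity_offdiag_ge0 hQ).
- by rewrite invr_ge0 ltW.
apply: eq_esum => l _; case: ifP => _; last by rewrite mule0.
by rewrite mulr1 -EFinM mulrC.
Qed.

(** From a subinvariant state no deadline for the next sojourn improves on
    stopping at once.  Above [lam] the deadline weighs the cost of jumping
    against [a j] in fixed proportions; below, every summand is at least [a j]. *)
Lemma one_step_ge j (H : \bar R) : subinvariant j -> 0 <= H ->
  (a j)%:E <= \esum_(l in [set: S]) ((jump_prob q j l)%:E *
    \int[exponential_law (intensity_rate_gt0 hQ j)]_u
      (stage_cost lam (a l) (a j) H u)%:E).
Proof.
move=> sub H0; set E := exponential_law _.
have a0 l : (0 <= a l)%R by exact: ltW.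
have p0 := jump_prob_ge0 hQ j.
case: sub => [rl|[lr ale]].
  rewrite -[leLHS]mule1 -(esum_jump_prob1 j) -esumZ //; last first.
  apply: le_esum => l _; rewrite muleC lee_wpmul2l ?lee_fin //.
  exact: integral_stage_cost_subcritical.
set s := survival (rate q j - lam) H.
have d0 : (0 < rate q j - lam)%R by rewrite subr_gt0.
have s0 : (0 <= s)%R by exact: survival_ge0.
have s1 : (0 <= 1 - s)%R by rewrite subr_ge0 survival_le1.
have r0 : (0 < rate q j)%R := intensity_rate_gt0 hQ j.
pose m l := (rate q j / (rate q j - lam) * a l)%R.
have m0 l : (0 <= m l)%R by rewrite !mulr_ge0 // ?invr_ge0 ltW.
rewrite (eq_esum (b := fun l => (1 - s)%:E * (jump_prob q j l * m l)%:E +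
   (s * a j)%:E * (jump_prob q j l)%:E)); last first.
  move=> l _; rewrite integral_stage_cost_supercritical // -/s -!EFinM -EFinD.
  by rewrite -/(m l); congr EFin; ring.
have pm0 l : 0 <= (jump_prob q j l * m l)%:E.
  by rewrite lee_fin; apply: mulr_ge0.
have pE0 l : 0 <= (jump_prob q j l)%:E by rewrite lee_fin.
have sa0 : (0 <= s * a j)%R by exact: mulr_ge0.
rewrite esumD; last 2 first.
- by move=> l _; apply: mule_ge0 => //; rewrite lee_fin.
- by move=> l _; apply: mule_ge0 => //; rewrite lee_fin.
rewrite !esumZ // esum_jump_prob1 mule1 esum_jump_prob.
rewrite (eq_esum (b := fun l => (q j l / (rate q j - lam) * a l)%:E)); last first.
  move=> l _; congr EFin; rewrite /m; field.
  by rewrite !gt_eqF.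
rewrite (_ : (a j)%:E = (1 - s)%:E * (a j)%:E + (s * a j)%:E); last first.
  by rewrite -EFinM -EFinD; congr EFin; ring.
by rewrite leeD2r // lee_wpmul2l // lee_fin.
Qed.

End one_step.

Section submartingale.
Context {d : measure_display} {Omega : measurableType d} {R : realType}
  {S : countType} {q : S -> S -> R} {X : R -> Omega -> S}
  {T : nat -> Omega -> R} {P : S -> probability Omega R}.
Hypothesis hQ : intensity_matrix q.
Hypothesis hX : markov_chain q X T P.
Variable h : nat -> R -> S -> \bar R.
Hypothesis hh : markovian X T P h.
Variables (a : S -> R) (lam : R) (A0 : set S).
Hypothesis a_gt0 : forall j, 0 < a j.
Hypothesis A0_sub : forall j, A0 j -> subinvariant (q := q) a lam j.
Hypothesis A0_closed : forall i j, A0 i -> j != i -> q i j != 0 -> A0 j.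
Local Notation Z := (embedded X T).
Local Notation M := (stopped_cost (X := X) (T := T) h a lam).
Local Notation U n := [set w | unstopped T Z (pos_rule h) n w].
Local Open Scope ereal_scope.

Lemma embedded0 i j : j != i -> P i [set w | Z 0%N w = j] = 0.
Proof.
move=> ji; have := chain_law hX i 0%N (fun=> j) (B := fun=> setT).
rewrite big_ord0 (negbTE ji) mul0e => <- //.
congr (P i _); apply/seteqP; split => w /=.
  by move=> Zj; split => // k; rewrite leqn0 => /eqP ->.
by move=> [+ _]; apply.
Qed.

Lemma history_unstopped (i : S) n : <<s cylinders X T n >> (U n).
Proof.
apply: (@measurable_unstopped _ (history X T n)).
- exact: measurable_pos_rule hh.
- by move=> k kn; exact: (history_time hX i).
- by move=> k kn j; apply: history_embedded; exact: ltnW.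
Qed.

(** States that cannot be reached in one jump from [A0] have jump probability
    zero, so the chain started in [A0] stays there almost surely. *)
Lemma embedded_closed i n j : A0 i -> ~ A0 j -> P i [set w | Z n w = j] = 0.
Proof.
move=> Ai; elim: n j => [|n IH] l nl.
  by apply: embedded0; apply/eqP => li; rewrite li in nl.
have mZ k j : measurable [set w | Z k w = j].
  exact: (measurable_embedded hX).
rewrite -[LHS]mul1e -integral_cst // (ge0_integral_fibers (Z n)) //.
apply: esum1 => j _; rewrite integral_cst ?mul1e; last exact: measurableI.
have := @markov_property _ _ _ _ _ _ _ _ hQ hX i n setT j l setT
  (@measurableT _ (history X T n)) measurableT.
rewrite preimage_setT setIT !setTI => Ptr.
transitivity (P i (transition X T n j l)); first by rewrite setIC.
rewrite Ptr.
have [Aj|nj] := pselect (A0 j); last by rewrite IH // mul0e.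
rewrite (_ : jump_prob q j l = 0%R) ?mul0e ?mule0 // /jump_prob.
case: eqVneq => // lj.
have [->|ne] := eqVneq (q j l) 0%R; first by rewrite mul0r.
by exfalso; apply: nl; exact: A0_closed ne.
Qed.

Lemma measurable_jump_cost n j l : measurable_fun setT (fun z : R * R =>
  (expR (lam * z.1) * stage_cost lam (a l) (a j) (pos_rule h n z.1 j) z.2)%R).
Proof.
have mH : measurable_fun setT (fun z : R * R => pos_rule h n z.1 j).
  exact: (measurableT_comp (measurable_pos_rule hh n j)).
apply: measurable_funM.
  by apply: measurableT_comp => //; apply: measurable_funM.
apply: measurable_fun_ifT => /=.
- apply: measurable_fun_lee => //; exact/measurable_EFinP.
- apply: measurable_funM => //.
  by apply: measurableT_comp => //; apply: measurable_funM.
- apply: measurable_funM => //; apply: measurableT_comp => //.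
  by apply: measurable_funM => //; exact: measurableT_comp.
Qed.

Lemma measurable_stopped_cost n : measurable_fun setT (M n).
Proof.
have mZ k j : measurable [set w | Z k w = j].
  exact: (measurable_embedded hX).
have mT k := measurable_time hX k.
elim: n => [|n IH].
  rewrite (_ : M 0%N = fun w => a (Z 0%N w)); last first.
    by apply/funext => w; rewrite (stopped_cost0 hX hh).
  exact: (measurable_fibers (F := fun j _ => a j)).
pose F (jl : S * S) w := (expR (lam * T n w) *
  stage_cost lam (a jl.2) (a jl.1) (pos_rule h n (T n w) jl.1) (sojourn T n w))%R.
rewrite (_ : M n.+1 = fun w =>
    if `[< unstopped T Z (pos_rule h) n w >]
    then F (Z n w, Z n.+1 w) w else M n w).
  apply: measurable_fun_ifT => //.
    apply: (measurable_fun_bool true).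
    rewrite setTI (_ : _ @^-1` _ = U n).
      by apply: measurable_unstopped => //; exact: measurable_pos_rule hh.
    by apply/seteqP; split => w /= /asboolP.
  apply: (measurable_fibers (Z := fun w => (Z n w, Z n.+1 w))) => //.
    move=> [j l]; rewrite (_ : [set _ | _] = transition X T n j l).
      exact: (measurable_transition hX).
    by apply/seteqP; split => w /= [Zj Zl]; [split|rewrite Zj Zl].
  have mTD : measurable_fun setT (fun w => (T n w, sojourn T n w)).
    by apply: measurable_fun_pair => //; exact: (measurable_sojourn hX).
  move=> [j l]; rewrite /F /=.
  exact: (measurableT_comp (measurable_jump_cost n j l) mTD).
apply/funext => w; case: ifPn => /asboolP un.
  by rewrite (stopped_cost_step hX hh).
by rewrite (stopped_cost_stopped hX hh).
Qed.

Lemma stopped_cost_ge0 n w : 0 <= (M n w)%:E.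
Proof. by rewrite lee_fin mulr_ge0 ?expR_ge0 // ltW. Qed.

(** Conditioning on the next state and on the history turns the cost after one
    more sojourn into the average bounded below by [one_step_ge]. *)
Lemma integral_unstopped_le i n j : A0 j ->
  \int[P i]_(w in U n `&` [set w | Z n w = j]) (M n w)%:E <=
  \int[P i]_(w in U n `&` [set w | Z n w = j]) (M n.+1 w)%:E.
Proof.
move=> Aj; set D := _ `&` _; set E := exponential_law (intensity_rate_gt0 hQ j).
have hU := @history_unstopped i n; have mU := history_measurable hX hU.
have mZ k l : measurable [set w | Z k w = l].
  exact: (measurable_embedded hX).
have mM k : measurable_fun setT (fun w => (M k w)%:E).
  by apply/measurable_EFinP; exact: measurable_stopped_cost.
have mD : measurable D by exact: measurableI.
pose phi l t u : \bar R :=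
  (expR (lam * t) * stage_cost lam (a l) (a j) (pos_rule h n t j) u)%:E.
have mphi l : measurable_fun setT (fun z : R * R => phi l z.1 z.2).
  by apply/measurable_EFinP; exact: measurable_jump_cost.
have phi0 l t u : 0 <= phi l t u.
  by rewrite lee_fin mulr_ge0 ?expR_ge0 ?stage_cost_ge0 // ltW.
have mF l : measurable_fun setT (fun t => \int[E]_u phi l t u).
  exact: (measurable_fun_fubini_tonelli_F (m2 := E) _ (mphi l)
    (fun z => phi0 l z.1 z.2)).
have p0 l := jump_prob_ge0 hQ j l.
rewrite [leRHS](ge0_integral_fibers (Z n.+1)) //; last 2 first.
- exact: measurable_funTS.
- by move=> w _; exact: stopped_cost_ge0.
have E1 l : \int[P i]_(w in D `&` [set w | Z n.+1 w = l]) (M n.+1 w)%:E =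
    \int[P i]_(w in D) ((jump_prob q j l)%:E * \int[E]_u phi l (T n w) u).
  rewrite ge0_integralZl_EFin //; last 2 first.
  - by move=> w _; exact: integral_ge0.
  - apply: measurable_funTS.
    exact: (measurableT_comp (mF l) (measurable_time hX n)).
  rewrite -(integral_markov_property hQ hX i j l hU (mphi l) (phi0 l)).
  rewrite -setIA; apply: eq_integral => w /set_mem [/= un [/= Zj Zl]].
  by rewrite (stopped_cost_step hX hh a lam un) Zj Zl.
under [leRHS]eq_esum do rewrite E1.
rewrite -integral_esum //; last 2 first.
- move=> l; apply: emeasurable_funM => //; apply: measurable_funTS.
  exact: (measurableT_comp (mF l) (measurable_time hX n)).
- by move=> l w _; rewrite mule_ge0 ?lee_fin // integral_ge0.
apply: ge0_le_integral => //.
- by move=> w _; exact: stopped_cost_ge0.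
- exact: measurable_funTS.
- apply: measurable_esum => //.
  + move=> l; apply: emeasurable_funM => //; apply: measurable_funTS.
    exact: (measurableT_comp (mF l) (measurable_time hX n)).
  + by move=> l w _; rewrite mule_ge0 ?lee_fin // integral_ge0.
move=> w [un Zj]; rewrite (stopped_cost_unstopped hX hh a lam un) Zj.
rewrite mulrC EFinM.
rewrite (eq_esum (b := fun l => (expR (lam * T n w))%:E * ((jump_prob q j l)%:E *
  \int[E]_u (stage_cost lam (a l) (a j) (pos_rule h n (T n w) j) u)%:E))).
  rewrite esumZ ?expR_ge0 //.
    rewrite lee_wpmul2l ?lee_fin ?expR_ge0 //; apply: one_step_ge => //.
      exact: A0_sub.
    exact: (pos_rule_ge0 hh).
  move=> l; rewrite mule_ge0 ?lee_fin // integral_ge0 // => u _.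
  by rewrite lee_fin stage_cost_ge0 // ltW.
move=> l _; rewrite muleCA; congr (_ * _).
rewrite -ge0_integralZl_EFin ?expR_ge0 //.
- by move=> u _; rewrite lee_fin stage_cost_ge0 // ltW.
- exact: measurable_stage_cost.
Qed.

(** The costs differ only where the rule has not stopped before the [n]-th jump;
    there the inequality is applied state by state, the states outside [A0]
    having probability zero. *)
Lemma integral_stopped_cost_le i n : A0 i ->
  \int[P i]_w (M n w)%:E <= \int[P i]_w (M n.+1 w)%:E.
Proof.
move=> Ai; have hU := @history_unstopped i n.
have mU := history_measurable hX hU.
have mZ k l : measurable [set w | Z k w = l].
  exact: (measurable_embedded hX).
have mM k : measurable_fun setT (fun w => (M k w)%:E).
  by apply/measurable_EFinP; exact: measurable_stopped_cost.
have cut k : \int[P i]_w (M k w)%:E =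
    \int[P i]_(w in U n) (M k w)%:E + \int[P i]_(w in ~` U n) (M k w)%:E.
  rewrite -ge0_integral_setU ?setUv //.
  - exact: measurableC.
  - by move=> w _; exact: stopped_cost_ge0.
  - by rewrite disj_set2E setICr.
rewrite [leLHS]cut [leRHS]cut; apply: leeD; last first.
  rewrite le_eqVlt; apply/orP; left; apply/eqP.
  apply: eq_integral => w /set_mem nu.
  by rewrite (stopped_cost_stopped hX hh).
have fib k : \int[P i]_(w in U n) (M k w)%:E = \esum_(j in [set: S])
    \int[P i]_(w in U n `&` [set w | Z n w = j]) (M k w)%:E.
  apply: ge0_integral_fibers => //; first exact: measurable_funTS.
  by move=> w _; exact: stopped_cost_ge0.
rewrite [leLHS]fib [leRHS]fib.
apply: le_esum => j _; have [Aj|nj] := pselect (A0 j).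
  exact: integral_unstopped_le.
rewrite (@integral_null_set _ _ _ _ _ _ _ (mZ n j) (embedded_closed n Ai nj)).
  by apply: integral_ge0 => w _; exact: stopped_cost_ge0.
by move=> w [].
Qed.

End submartingale.

(** * Value function and maximizer *)

Section hitting_time.
Context {d : measure_display} {Omega : measurableType d} {R : realType}
  {S : countType} {q : S -> S -> R} {X : R -> Omega -> S}
  {T : nat -> Omega -> R} {P : S -> probability Omega R}.
Hypothesis hX : markov_chain q X T P.
Variables (A : set S) (f : S -> \bar R).
Hypothesis f0 : forall i, A i -> f i = 0%E.
Hypothesis fy : forall i, ~ A i -> f i = +oo%E.
Local Notation Z := (embedded X T).

Lemma markov_time_hitting (t : R) (w : Omega) :
  markov_time X T (fun _ _ => f) t w =
  ereal_inf [set s%:E | s in [set s | 0 <= s /\ A (X s w)]].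
Proof.
transitivity (markov_time X T (fun _ _ => f) 0 w) => //.
have fA i : (f i < +oo)%E -> A i.
  by move=> fi; apply: contrapT => /fy E; rewrite E in fi.
have [[k uk ck]|u] := markov_time_cases (X := X) (T := T) (fun _ _ => f) w.
  rewrite (markov_time_stop hX uk ck).
  have Ak : A (Z k w).
    apply: fA; rewrite ltNge leye_eq; apply/eqP => E.
    by move: ck; rewrite /planned_stop /pos_rule E addey.
  rewrite /planned_stop /pos_rule f0 // adde0; apply/eqP; rewrite eq_le.
  apply/andP; split; last first.
    apply: ereal_inf_lbound; exists (T k w) => //; split => //.
    exact: (time_ge0 hX).
  apply: le_ereal_inf_tmp => _ [s [s0 As] <-]; rewrite lee_fin.
  have [l ls] := chain_nonexplosive hX w s0; have /andP[ls0 _] := ls.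
  rewrite (path_at hX ls) in As.
  apply: le_trans ls0; apply: (time_mono hX); rewrite leqNgt; apply/negP => lk.
  have := uk l lk; rewrite /planned_stop /pos_rule f0 // adde0 lee_fin leNgt.
  by rewrite (chain_time_lt hX).
rewrite (markov_time_never hX u).
rewrite [X in ereal_inf X](_ : _ = set0) ?ereal_inf0 //.
apply/seteqP; split => // x [s [s0 As] _].
have [l ls] := chain_nonexplosive hX w s0.
rewrite (path_at hX ls) in As.
have := u l.+1 l (ltnSn l).
rewrite /planned_stop /pos_rule f0 // adde0 lee_fin leNgt.
by rewrite (chain_time_lt hX).
Qed.

End hitting_time.

Section value.
Context {d : measure_display} {Omega : measurableType d} {R : realType}
  {S : countType} {q : S -> S -> R} {X : R -> Omega -> S}
  {T : nat -> Omega -> R} {P : S -> probability Omega R}.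
Hypothesis hQ : intensity_matrix q.
Hypothesis hX : markov_chain q X T P.
Variables (g : S -> R) (c gamma : R).
Local Notation Z := (embedded X T).
Local Notation a := (fun j : S => expR (- gamma * g j)).
Local Notation lam := (c * gamma).
Local Notation EU := (expected_utility X P (exp_utility gamma) g c 0).
Local Open Scope ereal_scope.

Lemma expected_utilityE i tau : EU i tau =
  - \int[P i]_w (a (stopped X tau w) * expR (lam * fine (tau w)))%:E.
Proof.
rewrite -integral_ge0N; last by move=> w _; rewrite lee_fin mulr_ge0 ?expR_ge0.
apply: eq_integral => w _; rewrite /exp_utility -EFinN -expRD.
by congr (- expR _)%:E; ring.
Qed.

Lemma expected_utility_le0 i tau : EU i tau <= 0.
Proof.
rewrite expected_utilityE oppe_le0; apply: integral_ge0 => w _.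
by rewrite lee_fin mulr_ge0 ?expR_ge0.
Qed.

Lemma integral_start i (f : S -> R) : (forall j, (0 <= f j)%R) ->
  \int[P i]_w (f (Z 0%N w))%:E = (f i)%:E.
Proof.
move=> f0.
have mZ j : measurable [set w | Z 0%N w = j].
  exact: (measurable_embedded hX).
have mf : measurable_fun setT (fun w => (f (Z 0%N w))%:E).
  exact: (measurable_fibers (F := fun j _ => (f j)%:E)).
have P1 : P i [set w | Z 0%N w = i] = 1.
  have := chain_law hX i 0%N (fun=> i) (B := fun=> setT).
  rewrite big_ord0 eqxx mule1 => <- //.
  congr (P i _); apply/seteqP; split => w /=.
    by move=> Zi; split => // k; rewrite leqn0 => /eqP ->.
  by move=> [+ _]; apply.
rewrite (ge0_integral_fibers (Z 0%N)) //; last first.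
  by move=> w _; rewrite lee_fin.
have E j : \int[P i]_(w in setT `&` [set w | Z 0%N w = j]) (f (Z 0%N w))%:E =
    (f j)%:E * P i [set w | Z 0%N w = j].
  rewrite setTI -integral_cst //; apply: eq_integral => w /set_mem /= ->.
  by [].
under eq_esum do rewrite E.
rewrite (esumID [set i]) // ?setTI;
  last by move=> j _; rewrite mule_ge0 ?lee_fin.
rewrite esum_set1 ?P1 ?mule1 ?lee_fin // esum1 ?adde0 // => j ji.
by rewrite (embedded0 hX) ?mule0 //; exact/eqP.
Qed.

Lemma expW_le0 i : expW X T P g c gamma i <= 0.
Proof.
by apply: ge_ereal_sup => _ [h _ <-]; exact: expected_utility_le0.
Qed.

(** Stopping at time [0] is a Markovian rule. *)
Lemma expW_ge i : (- a i)%:E <= expW X T P g c gamma i.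
Proof.
pose h (k : nat) (s : R) (j : S) : \bar R := 0.
have h0 t w : markov_time X T h t w = 0.
  transitivity (markov_time X T h 0 w) => //.
  have c0 : planned_stop T Z (pos_rule h) 0 w = 0.
    by rewrite /planned_stop adde0 (chain_time0 hX).
  rewrite (@markov_time_stop _ _ _ _ _ _ _ _ hX h 0%N w) // c0.
  by rewrite lte_fin -[X in (X < _)%R](chain_time0 hX w) (chain_time_lt hX).
apply: ereal_sup_ubound; exists h.
  split => // j t t0.
  rewrite (_ : [set _ | _] = setT) ?probability_setT //.
  by apply/seteqP; split => // w _ /=; rewrite h0.
rewrite expected_utilityE EFinN -(integral_start i (f := a)) //.
congr (- _); apply: eq_integral => w _.
by rewrite /stopped h0 /= mulr0 expR0 mulr1 /embedded (chain_time0 hX).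
Qed.

Lemma maximizer_cont i : (lam < rate q i)%R ->
  maximizer q X T P g c gamma i =
  if stop_value g gamma i < continue_value q X T P g c gamma i then +oo else 0.
Proof.
move=> lr; rewrite /maximizer leNgt lr /=.
have [cs|sc] := leP (continue_value q X T P g c gamma i) (stop_value g gamma i).
  by rewrite eqxx.
by rewrite gt_eqF.
Qed.

(** All values are nonpositive, so the positive part of the sum vanishes. *)
Lemma continue_valueE i : (lam < rate q i)%R ->
  continue_value q X T P g c gamma i =
  - \esum_(j in [set j | j != i])
      ((q i j / (rate q i - lam))%:E * - expW X T P g c gamma j).
Proof.
move=> lr; rewrite /continue_value /sum_over.
have coef_ge0 j : j != i -> (0 <= q i j / (rate q i - lam))%R.
  by move=> ji; rewrite divr_ge0 ?(intensity_offdiag_ge0 hQ) // subr_ge0 ltW.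
have f0 j : [set j | j != i] j ->
    (q i j / (rate q i - lam))%:E * expW X T P g c gamma j <= 0.
  by move=> /= ji; rewrite mule_ge0_le0 ?lee_fin ?coef_ge0 // expW_le0.
rewrite esum1 ?add0e; last first.
  by move=> j ji; rewrite (le0_funeposE f0) ?inE.
congr (- _); apply: eq_esum => j ji.
by rewrite (le0_funenegE f0) ?inE //= muleN.
Qed.

Lemma maximizer_continue i : ~ stop_set q g c gamma i ->
  maximizer q X T P g c gamma i = +oo.
Proof.
move=> nS.
have lr : (lam < rate q i)%R.
  by rewrite ltNge; apply/negP => rl; apply: nS; right.
rewrite maximizer_cont // ifT // continue_valueE // /stop_value EFinN lteN2.
apply: (@le_lt_trans _ _ (\esum_(j in [set j | j != i])
    (q i j / (rate q i - lam) * a j)%:E)).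
  apply: le_esum => j ji; rewrite [leRHS]EFinM lee_wpmul2l ?lee_fin //.
    by rewrite divr_ge0 ?(intensity_offdiag_ge0 hQ) // subr_ge0 ltW.
  by rewrite leeNl -EFinN expW_ge.
by rewrite ltNge; apply/negP => le; apply: nS; left.
Qed.

Hypothesis hA2 : assumption_A2 X T P (exp_utility gamma) g c.
Hypothesis hS0 : forall i j, stop_set q g c gamma i -> j != i -> q i j != 0%R ->
  stop_set q g c gamma j.

Lemma stop_set_subinvariant j : stop_set q g c gamma j ->
  subinvariant (q := q) a lam j.
Proof. by case=> [[]|]; [right|left]. Qed.

(** (A2) bounds the utility of [tau] by the limit inferior of the utilities at
    [tau /\ S_n], each of which is at most [- a i]. *)
Lemma expW_stop_set i : stop_set q g c gamma i ->
  expW X T P g c gamma i = (- a i)%:E.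
Proof.
move=> Si; apply/eqP; rewrite eq_le expW_ge andbT.
apply: ge_ereal_sup => _ [h hh <-].
apply: (le_trans (hA2 i (lexx 0%R) (markov_time_stopping hX hh))).
have a0 j : (0 < a j)%R by exact: expR_gt0.
have Mn n : (a i)%:E <=
    \int[P i]_w (stopped_cost (X := X) (T := T) h a lam n w)%:E.
  elim: n => [|n IH].
    rewrite -(integral_start i (f := a)) //.
    rewrite le_eqVlt; apply/orP; left; apply/eqP; apply: eq_integral => w _.
    by rewrite (stopped_cost0 hX hh).
  apply: (le_trans IH).
  exact: (integral_stopped_cost_le hQ hX hh a0 stop_set_subinvariant hS0).
have EUn n : EU i (stop_min (markov_time X T h 0) T n) <= (- a i)%:E.
  by rewrite expected_utilityE EFinN leeN2; exact: Mn.
exact: limn_einf_le.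
Qed.

Lemma maximizer_stop_set i : stop_set q g c gamma i ->
  maximizer q X T P g c gamma i = 0.
Proof.
move=> Si; have [rl|lr] := leP (rate q i) lam; first by rewrite /maximizer rl.
rewrite maximizer_cont // ifF //; apply/negbTE; rewrite -leNgt.
rewrite continue_valueE // /stop_value EFinN leeN2.
case: (Si) => [[le _]|]; last by rewrite leNgt lr.
apply: (le_trans le); apply: le_esum => j ji.
have [->|qij] := eqVneq (q i j) 0%R; first by rewrite !mul0r mul0e.
by rewrite expW_stop_set ?EFinN ?oppeK -?EFinM //; exact: hS0 qij.
Qed.

End value.

Theorem theorem6p3 (d : measure_display) (Omega : measurableType d)
    (R : realType) (S : countType) (q : S -> S -> R)
    (X : R -> Omega -> S) (T : nat -> Omega -> R)
    (P : S -> probability Omega R) (g : S -> R) (c gamma : R)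
    (hQ : intensity_matrix q) (hX : markov_chain q X T P)
    (hc : 0 < c) (hgamma : 0 < gamma)
    (hA1 : assumption_A1 X P g c)
    (hA2 : assumption_A2 X T P (exp_utility gamma) g c)
    (hS0 : forall i j : S, stop_set q g c gamma i -> j != i -> q i j != 0 ->
       stop_set q g c gamma j) :
  [/\ forall i : S, stop_set q g c gamma i ->
        maximizer q X T P g c gamma i = 0%E /\
        expW X T P g c gamma i = (- expR (- gamma * g i))%:E,
      forall i : S, ~ stop_set q g c gamma i ->
        maximizer q X T P g c gamma i = +oo%E
    & forall (t : R) (w : Omega), 0 <= t ->
        markov_time X T (fun _ _ i => maximizer q X T P g c gamma i) t w =
        ereal_inf [set s%:E | s in [set s | 0 <= s /\
                                     stop_set q g c gamma (X s w)]]].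
Proof.
have stop i : stop_set q g c gamma i -> maximizer q X T P g c gamma i = 0%E.
  exact: (maximizer_stop_set hQ hX hA2 hS0).
have cont i : ~ stop_set q g c gamma i ->
    maximizer q X T P g c gamma i = +oo%E.
  exact: (maximizer_continue hQ hX).
split => // [i Si|t w _].
  by split; [exact: stop|exact: (expW_stop_set hQ hX hA2 hS0)].
exact: (markov_time_hitting hX stop cont).
Qed.
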